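(* Let $M_1$ and $M_2$ be compact Riemannian manifolds without boundary (not necessarily connected) with the same volume, $|M_1|=|M_2|$. Then $M_1$ and $M_2$ are isoheat, i.e. $Q_{M_1}(t)=Q_{M_2}(t)$ for all $t>0$.
   Context: For a compact Riemannian manifold $(M,g)$, not necessarily connected, with Riemannian volume measure $dx$ and Laplace–Beltrami operator $\Delta_M$ (with Dirichlet boundary conditions if $\partial M\neq\emptyset$; no boundary condition is needed if $\partial M=\emptyset$), let $u:M\times[0,\infty)\to\mathbb{R}$ be the unique solution of $\Delta_M u=\partial u/\partial t$, $t>0$, with $\lim_{t\downarrow 0}u(\cdot;t)=1$ in $L^2(M)$. The heat content of $M$ is $Q_M(t)=\int_M u(x;t)\,dx$. The volume is $|M|=\int_M 1\,dx$. Two manifolds $M_1,M_2$ are isoheat if $Q_{M_1}(t)=Q_{M_2}(t)$ for all $t>0$. *)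

(* Defs.v *)
From HB Require Import structures.
From mathcomp Require Import all_boot all_order all_algebra.
From mathcomp Require Import all_classical all_reals all_analysis.
Import Order.TTheory GRing.Theory Num.Theory.
Import numFieldNormedType.Exports.

Set Implicit Arguments.
Unset Strict Implicit.
Unset Printing Implicit Defensive.

Local Open Scope classical_set_scope.
Local Open Scope ring_scope.

(** * Powers of a sigma-finite measure and Lebesgue measure on [R^n] *)

Section tuple_cons.
Context d (T : measurableType d) (n : nat).

Definition tuple_cons (p : T * n.-tuple T) : n.+1.-tuple T :=
  [tuple of p.1 :: p.2].

Definition tuple_uncons (t : n.+1.-tuple T) : T * n.-tuple T :=
  (thead t, [tuple of behead t]).

Lemma tuple_consK : cancel tuple_cons tuple_uncons.
Proof. by case=> x t; congr pair; apply: val_inj. Qed.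

Lemma measurable_tuple_cons : measurable_fun setT tuple_cons.
Proof.
by apply: measurable_cons; [exact: measurable_fst|exact: measurable_snd].
Qed.

Lemma measurable_tuple_uncons : measurable_fun setT tuple_uncons.
Proof.
apply/measurable_fun_pairP; split; last exact: measurable_behead.
exact: measurable_tnth.
Qed.

End tuple_cons.

Lemma product_measure_sigma_finiteT d1 d2 (T1 : measurableType d1)
    (T2 : measurableType d2) (R : realType)
    (m1 : {sigma_finite_measure set T1 -> \bar R})
    (m2 : {sigma_finite_measure set T2 -> \bar R}) :
  sigma_finite setT (m1 \x m2)%E.
Proof.
have /sigma_finiteP[F [TF ndF Foo]] := sigma_finiteT m1.
have /sigma_finiteP[G [TG ndG Goo]] := sigma_finiteT m2.
exists (fun k => F k `*` G k).
  rewrite -setXTT TF TG predeqE => -[x y]; split.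
    move=> [/= [i _ Fix] [j _ Gjy]]; exists (maxn i j) => //; split.
      by move: x Fix; exact/subsetPset/ndF/leq_maxl.
    by move: y Gjy; exact/subsetPset/ndG/leq_maxr.
  by move=> [k _ []/= ? ?]; split; exists k.
move=> k; have [? ?] := Foo k; have [? ?] := Goo k.
split; first exact: measurableX.
by rewrite product_measure1E// lte_mul_pinfty// ge0_fin_numE.
Qed.

Section cons_measure.
Local Open Scope ereal_scope.
Context d (T : measurableType d) (R : realType) (n : nat).
Variables (m1 : {sigma_finite_measure set T -> \bar R})
  (m2 : {sigma_finite_measure set (n.-tuple T) -> \bar R}).

Definition cons_measure : set (n.+1.-tuple T) -> \bar R :=
  pushforward (m1 \x m2) (@tuple_cons _ T n).

Let cons_measure0 : cons_measure set0 = 0.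
Proof. by rewrite /cons_measure /pushforward preimage_set0 measure0. Qed.

Let cons_measure_ge0 A : 0 <= cons_measure A.
Proof. by rewrite /cons_measure /pushforward; exact: measure_ge0. Qed.

Let cons_measure_sigma_additive : semi_sigma_additive cons_measure.
Proof.
exact: (@measure_semi_sigma_additive _ _ _
  (measure_function_pushforward__canonical__measure_function_Measure
     (m1 \x m2) (@measurable_tuple_cons _ T n))).
Qed.

HB.instance Definition _ := isMeasure.Build _ _ _ cons_measure
  cons_measure0 cons_measure_ge0 cons_measure_sigma_additive.

Let cons_measure_sigma_finite : sigma_finite setT cons_measure.
Proof.
have [F TF Foo] := product_measure_sigma_finiteT m1 m2.
exists (fun k => @tuple_uncons _ T n @^-1` F k).
  by rewrite -preimage_bigcup -TF preimage_setT.
move=> k; have [mF Fk] := Foo k; split.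
  by rewrite -[X in measurable X]setTI; exact: measurable_tuple_uncons.
rewrite /cons_measure /pushforward -comp_preimage.
by rewrite (_ : _ \o _ = id) //; apply/funext => p; exact: tuple_consK.
Qed.

HB.instance Definition _ := Measure_isSigmaFinite.Build _ _ _ cons_measure
  cons_measure_sigma_finite.

End cons_measure.

Fixpoint power_measure d (T : measurableType d) (R : realType)
    (m : {sigma_finite_measure set T -> \bar R}) (n : nat) :
    {sigma_finite_measure set (n.-tuple T) -> \bar R} :=
  match n with
  | 0 => \d_[tuple]
  | k.+1 => cons_measure m (power_measure m k)
  end.

Definition lebesgue_tuple (R : realType) (n : nat) :
    {sigma_finite_measure set (n.-tuple (measurableTypeR R)) -> \bar R} :=
  power_measure (@lebesgue_measure R) n.

(** The library puts the product sigma-algebra on tuples, and the topology and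
    the derivatives on row vectors. *)
Definition row_of_tuple (R : realType) (n : nat)
  (t : n.-tuple (measurableTypeR R)) : 'rV[R]_n := \row_i tnth t i.

(** * Differentiability classes on an open subset of [R^n]

    [U] is meant to be open; values of [f] outside [U] are irrelevant. *)

Fixpoint Ck (R : realType) (n : nat) (V : normedModType R) (k : nat)
    (U : set 'rV[R]_n) (f : 'rV[R]_n -> V) : Prop :=
  match k with
  | 0 => forall x, U x -> {for x, continuous f}
  | j.+1 => (forall x, U x -> differentiable f x) /\
            (forall i : 'I_n, Ck j U (fun x => 'D_(delta_mx 0 i) f x))
  end.

Definition Cinfty (R : realType) (n : nat) (V : normedModType R)
  (U : set 'rV[R]_n) (f : 'rV[R]_n -> V) : Prop := forall k, Ck k U f.

(** * Closed Riemannian manifolds *)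

(** A homeomorphism from the open set [cdom] onto an open subset of [R^n],
    with inverse [cinv]; both maps are total, with irrelevant values outside
    these two open sets. *)
Record chart (R : realType) (n : nat) (M : topologicalType) := Chart {
  cdom : set M;
  cmap :> M -> 'rV[R]_n;
  cinv : 'rV[R]_n -> M;
  cdom_open : open cdom;
  cimg_open : open (cmap @` cdom);
  cmapK : forall x, cdom x -> cinv (cmap x) = x;
  cmap_continuous : forall x, cdom x -> {for x, continuous cmap};
  cinv_continuous : forall y, (cmap @` cdom) y -> {for y, continuous cinv}
}.

Definition cimg (R : realType) (n : nat) (M : topologicalType)
  (c : chart R n M) : set 'rV[R]_n := c @` cdom c.

Definition transition (R : realType) (n : nat) (M : topologicalType)
  (c c' : chart R n M) : 'rV[R]_n -> 'rV[R]_n := c' \o cinv c.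

Definition overlap (R : realType) (n : nat) (M : topologicalType)
  (c c' : chart R n M) : set 'rV[R]_n := c @` (cdom c `&` cdom c').

Definition borel (M : ptopologicalType) : measurableType _ :=
  g_sigma_algebraType (@open M).

(** Closed = compact without boundary; connectedness is not required.

    [metric i y] is the Gram matrix of the metric at the point of coordinates
    [y] in the chart [i]: two tangent vectors of coordinates [v] and [w] (as row
    vectors) have inner product [v *m metric i y *m w^T].  Since Jacobian
    matrices act on the right of row vectors, the change of chart [tau] pulls
    the metric back as [J *m _ *m J^T] with [J := jacobian tau y].

    The library's measurable types are pointed, whence the pointed [carrier].

    [volume] is the Riemannian volume measure: [volumeE] is the usual formula
    [dx = sqrt (det g) dy] in each chart, and it determines the measure since
    [carrier] is covered by countably many of the charts. *)
Record closedRiemannian (R : realType) (n : nat) := ClosedRiemannian {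
  carrier :> ptopologicalType;
  hausdorff : hausdorff_space carrier;
  countable_base : @second_countable carrier;
  compactT : compact [set: carrier];
  chart_index : Type;
  atlas : chart_index -> chart R n carrier;
  atlas_cover : forall x, exists i, cdom (atlas i) x;
  atlas_smooth : forall i j,
    Cinfty (overlap (atlas i) (atlas j)) (transition (atlas i) (atlas j));
  metric : chart_index -> 'rV[R]_n -> 'M[R]_n;
  metric_smooth : forall i, Cinfty (cimg (atlas i)) (metric i);
  metric_symmetric : forall i y, cimg (atlas i) y -> (metric i y)^T = metric i y;
  metric_posdef : forall i y (v : 'rV[R]_n), cimg (atlas i) y -> v != 0 ->
    0 < (v *m metric i y *m v^T) 0 0;
  metric_compat : forall i j y, overlap (atlas i) (atlas j) y ->
    let tau := transition (atlas i) (atlas j) in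
    metric i y = jacobian tau y *m metric j (tau y) *m (jacobian tau y)^T;
  volume : {measure set (borel carrier) -> \bar R};
  volumeE : forall i (A : set (borel carrier)),
    measurable A -> A `<=` cdom (atlas i) ->
    (volume A =
      \int[@lebesgue_tuple R n]_(t in @row_of_tuple R n @^-1` (atlas i @` A))
        (Num.sqrt (\det (metric i (row_of_tuple t))))%:E)%E
}.

Definition total_volume (R : realType) (n : nat)
  (M : closedRiemannian R n) : \bar R := (\int[volume M]_x 1)%E.

Definition local_rep (R : realType) (n : nat) (M : closedRiemannian R n)
  (i : chart_index M) (f : M -> R) : 'rV[R]_n -> R := f \o cinv (atlas i).

Definition sqrt_det_metric (R : realType) (n : nat) (M : closedRiemannian R n)
  (i : chart_index M) (y : 'rV[R]_n) : R := Num.sqrt (\det (metric i y)).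

(** [(1 / sqrt (det g)) \sum_j d_j (sqrt (det g) \sum_k g^{jk} d_k f)] *)
Definition local_laplacian (R : realType) (n : nat) (M : closedRiemannian R n)
    (i : chart_index M) (F : 'rV[R]_n -> R) (y : 'rV[R]_n) : R :=
  (sqrt_det_metric i y)^-1 *
  \sum_(j < n) 'D_(delta_mx 0 j) (fun z => sqrt_det_metric i z *
    \sum_(k < n) invmx (metric i z) j k * 'D_(delta_mx 0 k) F z) y.

(** [h] is the Laplace-Beltrami operator applied to the C^2 function [f]: the
    coordinate expression does not depend on the chart. *)
Definition is_laplacian (R : realType) (n : nat) (M : closedRiemannian R n)
    (f h : M -> R) : Prop :=
  forall i x, cdom (atlas i) x ->
    h x = local_laplacian i (local_rep i f) (atlas i x).

(** * Heat content *)

(** Classical solutions on [M * ]0, +oo[] with initial datum 1; the values of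
    [u x t] for [t <= 0] are irrelevant. *)
Record heat_solution (R : realType) (n : nat) (M : closedRiemannian R n)
    (u : M -> R -> R) : Prop := HeatSolution {
  heat_continuous : forall (x : M) (t : R), 0 < t ->
    {for (x, t), continuous (fun p : M * R => u p.1 p.2)};
  heat_C2 : forall i (t : R), 0 < t -> Ck 2 (cimg (atlas i)) (local_rep i (u ^~ t));
  heat_derivable : forall (x : M) (t : R), 0 < t -> derivable (u x) t 1;
  heat_dt_continuous : forall (x : M) (t : R), 0 < t ->
    {for (x, t), continuous (fun p : M * R => derive1 (u p.1) p.2)};
  heat_eq : forall t : R, 0 < t -> is_laplacian (u ^~ t) (fun x => derive1 (u x) t);
  heat_initial :
    ('N[volume M]_2%:E[EFin \o (fun x => u x t - 1)%R])%E @[t --> 0^'+] --> 0%E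
}.

(** The solution [u]: [get] is Hilbert's choice operator, so nothing about
    existence or uniqueness is assumed here.  (The solution exists, and is
    unique up to its irrelevant values for [t <= 0].) *)
Definition heat_flow (R : realType) (n : nat) (M : closedRiemannian R n) :
  M -> R -> R := get (@heat_solution R n M).
Arguments heat_flow {R n} M _ _.

Definition heat_content (R : realType) (n : nat) (M : closedRiemannian R n)
  (t : R) : \bar R := (\int[volume M]_x (heat_flow M x t)%:E)%E.

Definition isoheat (R : realType) (n1 n2 : nat) (M1 : closedRiemannian R n1)
  (M2 : closedRiemannian R n2) : Prop :=
  forall t : R, 0 < t -> heat_content M1 t = heat_content M2 t.

(* Main.v *)
Require Import Defs.
From HB Require Import structures.
From mathcomp Require Import all_boot all_order all_algebra.
From mathcomp Require Import finmap.
From mathcomp Require Import all_classical all_reals all_analysis.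
From mathcomp Require Import measurable_realfun.
Import Order.TTheory GRing.Theory Num.Theory.
Import numFieldNormedType.Exports.

Set Implicit Arguments.
Unset Strict Implicit.
Unset Printing Implicit Defensive.

(** The constant 1 solves the heat equation, so [heat_flow M] is some solution
    [u] with initial datum 1; uniqueness is not needed.  On a closed manifold
    the Laplacian of a C^2 function integrates to zero, hence the heat content
    [Q t] has zero derivative and is constant for [t > 0].  Since [u t - 1]
    tends to 0 in L^2 and the volume is finite, [Q t] tends to the volume as
    [t] tends to 0, so [Q] is identically the volume.

    For the divergence theorem, take a C^1 partition of unity [phi_a] with
    [phi_a] supported in a chart.  Then [div (phi_a grad f)] integrates to zero
    by Fubini and the fundamental theorem of calculus in that chart, it equals
    [phi_a * Laplacian f + <grad phi_a, grad f>], and the gradients of the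
    [phi_a] sum to zero; the pairing of gradients does not depend on the chart
    by the chain rule and the compatibility of the metrics. *)

Local Open Scope classical_set_scope.
Local Open Scope ring_scope.

(** * C^1 functions at a point of [R^n] *)

Section differentiable_near.
Context {R : realType} {V W : normedModType R}.

(** The first-order expansion of [f] at [x] is also one of [g], and uniqueness of the differential
    makes its linear part the differential of [g]. *)
Lemma near_eq_differentiable (f g : V -> W) (x : V) :
  (\near x, f x = g x) -> differentiable f x -> differentiable g x.
Proof.
move=> fg df; have /diff_locallyP[dfc dfE] := df.
have gE : g \o shift x = cst (g x) + 'd f x +o_ 0 id.
  apply/eqaddoP => e e0.
  move/eqaddoP : dfE => /(_ _ e0) dfE.
  near=> h; have gf : (g \o shift x) h = (f \o shift x) h.
    rewrite /=; near: h; have := fg.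
    by rewrite (near_shift 0) /= subr0 => /filterS; apply.
  rewrite [(g \o _ - _) _]/(_ h - _) gf -(nbhs_singleton fg).
  by near: h.
have dgE := diff_unique dfc gE.
by apply/diff_locallyP; rewrite dgE.
Unshelve. all: by end_near. Qed.

Lemma derive_comp1 (f : V -> R) (g : R -> R) x v :
  differentiable f x -> derivable g (f x) 1 ->
  'D_v (g \o f) x = g^`()%classic (f x) * 'D_v f x.
Proof.
move=> df /derivable1_diffP dg.
rewrite deriveE; last exact: differentiable_comp.
rewrite diff_comp// derive1E' //= deriveE// -[X in 'd g _ X]mulr1.
by rewrite [LHS]linearZ mulrC.
Qed.

Lemma near_eq_continuous (T : topologicalType) (U : topologicalType)
  (f g : T -> U) (x : T) : (\near x, f x = g x) ->
  {for x, continuous f} -> {for x, continuous g}.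
Proof.
move=> fg cf; rewrite /prop_for /continuous_at -(nbhs_singleton fg).
exact: cvg_trans (near_eq_cvg fg) cf.
Qed.

End differentiable_near.

Section C1at.
Context {R : realType} {n : nat}.
Implicit Types (F G : 'rV[R]_n -> R) (x : 'rV[R]_n).

(** A property of the germ of [F] at [x]: differentiability is asked nearby, so that the rules of
    calculus hold around [x], and continuity of the partial derivatives at [x] itself. *)
Definition C1at F x := (\forall z \near x, differentiable F z) /\
  forall i, {for x, continuous (fun z => 'D_(delta_mx 0 i) F z)}.

Lemma C1at_differentiable F x : C1at F x -> differentiable F x.
Proof. by case=> /nbhs_singleton. Qed.

Lemma C1at_continuous F x : C1at F x -> {for x, continuous F}.
Proof. by move=> /C1at_differentiable/differentiable_continuous. Qed.

Lemma C1at_derivable F x v : C1at F x -> derivable F x v.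
Proof. by move=> /C1at_differentiable/diff_derivable. Qed.

Lemma C1at_continuous_derive F x i : C1at F x ->
  {for x, continuous (fun z => 'D_(delta_mx 0 i) F z)}.
Proof. by case. Qed.

Lemma near_eq_C1at F G x : (\near x, F x = G x) -> C1at F x -> C1at G x.
Proof.
move=> FG [dF cF].
have nFG : \forall z \near x, \near z, F z = G z by exact/nbhs_interior.
split.
  near=> z; apply: (@near_eq_differentiable _ _ _ F); last by near: z.
  by near: z.
move=> i; apply: near_eq_continuous (cF i); near=> z.
apply: near_eq_derive.
by near: z.
Unshelve. all: by end_near. Qed.

Lemma C1at_cst (a : R) x : C1at (cst a) x.
Proof.
split; first by near=> z; exact: differentiable_cst.
move=> i; rewrite (_ : (fun z => _) = cst 0); first exact: cst_continuous.
by apply/funext => z; rewrite derive_cst.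
Unshelve. all: by end_near. Qed.

Lemma C1atD F G x : C1at F x -> C1at G x -> C1at (fun z => F z + G z) x.
Proof.
move=> [dF cF] [dG cG]; split.
  by near=> z; apply: differentiableD; near: z.
move=> i; apply: near_eq_continuous (continuousD (cF i) (cG i)).
by near=> z; rewrite /= deriveD//; apply: diff_derivable; near: z.
Unshelve. all: by end_near. Qed.

Lemma C1atM F G x : C1at F x -> C1at G x -> C1at (fun z => F z * G z) x.
Proof.
move=> CF CG; have [[dF cF] [dG cG]] := (CF, CG); split.
  by near=> z; apply: differentiableM; near: z.
have [cF0 cG0] := (C1at_continuous CF, C1at_continuous CG).
move=> i.
apply: near_eq_continuous (continuousD (continuousM cF0 (cG i))
  (continuousM cG0 (cF i))).
by near=> z; rewrite /= deriveM//; apply: diff_derivable; near: z.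
Unshelve. all: by end_near. Qed.

Lemma C1at_sum I (r : seq I) (F : I -> 'rV[R]_n -> R) x :
  (forall i, C1at (F i) x) -> C1at (fun z => \sum_(i <- r) F i z) x.
Proof.
move=> CF; elim: r => [|a r ih].
  rewrite (_ : (fun z => _) = cst 0); first exact: C1at_cst.
  by apply/funext => z; rewrite big_nil.
rewrite (_ : (fun z => _) = fun z => F a z + \sum_(i <- r) F i z).
  exact: C1atD.
by apply/funext => z; rewrite big_cons.
Qed.

Lemma C1at_prod I (r : seq I) (F : I -> 'rV[R]_n -> R) x :
  (forall i, C1at (F i) x) -> C1at (fun z => \prod_(i <- r) F i z) x.
Proof.
move=> CF; elim: r => [|a r ih].
  rewrite (_ : (fun z => _) = cst 1); first exact: C1at_cst.
  by apply/funext => z; rewrite big_nil.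
rewrite (_ : (fun z => _) = fun z => F a z * \prod_(i <- r) F i z).
  exact: C1atM.
by apply/funext => z; rewrite big_cons.
Qed.

Lemma C1at_comp F (g : R -> R) x : C1at F x ->
  (\forall s \near F x, derivable g s 1) ->
  {for F x, continuous (g^`()%classic)} -> C1at (fun z => g (F z)) x.
Proof.
move=> CF dg cg; have [dF cF] := CF; have cF0 := C1at_continuous CF.
have dgF : \forall z \near x, derivable g (F z) 1 by exact: (cF0 _ dg).
split.
  near=> z; apply: (@differentiable_comp _ _ _ _ F g); first by near: z.
  by apply/derivable1_diffP; near: z.
move=> i; have cgF : {for x, continuous (fun z => g^`()%classic (F z))}.
  exact: continuous_comp.
apply: near_eq_continuous (continuousM cgF (cF i)).
near=> z; apply/esym; apply: (@derive_comp1 _ _ F g); by near: z.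
Unshelve. all: by end_near. Qed.

Lemma C1atV F x : C1at F x -> F x != 0 -> C1at (fun z => (F z)^-1) x.
Proof.
move=> CF F0.
have nz : \forall s \near F x, s != 0 :> R.
  by apply: open_nbhs_nbhs; split => //; exact: open_neq.
have dV s : s != 0 :> R -> derivable (@GRing.inv R) s 1.
  by move=> s0; apply/derivable1_diffP; exact: differentiable_Rinv.
apply: C1at_comp => //; first by apply: filterS nz.
have : {for F x, continuous (fun s : R => - (s ^- 2))}.
  apply: continuousN; apply: continuousV; first by rewrite expf_neq0.
  exact: exprn_continuous.
apply: near_eq_continuous; near=> s.
rewrite derive1E (@deriveV _ _ id)//; last by near: s.
by rewrite derive_id scaler1.
Unshelve. all: by end_near. Qed.

Lemma C1at_sqrt F x : C1at F x -> 0 < F x -> C1at (fun z => Num.sqrt (F z)) x.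
Proof.
move=> CF F0.
have nz : \forall s \near F x, 0 < s :> R.
  by apply: open_nbhs_nbhs; split => //; exact: open_gt.
apply: C1at_comp => //.
  near=> s; have s0 : 0 < s by near: s.
  by have [] := is_derive1_sqrt s0.
have : {for F x, continuous (fun s : R => (2 * Num.sqrt s)^-1)}.
  apply: continuousV; first by rewrite mulf_neq0// gt_eqF// sqrtr_gt0.
  apply: continuousM; first exact: cst_continuous.
  exact: sqrt_continuous.
apply: near_eq_continuous; near=> s; have s0 : 0 < s by near: s.
by have [_] := is_derive1_sqrt s0; rewrite derive1E => ->.
Unshelve. all: by end_near. Qed.

Lemma Ck1_C1at k (U : set 'rV[R]_n) F x : open U -> Ck k.+1 U F -> U x ->
    C1at F x.
Proof.
move=> oU [dF cF] Ux; split.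
  by near=> z; apply: dF; near: z; exact: open_nbhs_nbhs.
(* At order one, continuity of the partial derivatives is the last clause of [Ck]; at higher order
   it follows from their differentiability. *)
move=> i; case: k cF => [|k] cF; first exact: cF.
by have [dD _] := cF i; apply: differentiable_continuous; exact: dD.
Unshelve. all: by end_near. Qed.

Lemma Ck1_C1at_coord p m k (U : set 'rV[R]_n) (F : 'rV[R]_n ->
    'M[R]_(p, m)) x i j :
  open U -> Ck k.+1 U F -> U x -> C1at (fun z => F z i j) x.
Proof.
move=> oU [dF cF] Ux.
have nU : \forall z \near x, U z by exact: open_nbhs_nbhs.
split.
  near=> z.
  apply: (@differentiable_comp _ _ _ _ F (fun M : 'M[R]_(p, m) => M i j)).
    by apply: dF; near: z.
  exact: differentiable_coord.
move=> l.
have cFl : {for x, continuous (fun z => 'D_(delta_mx 0 l) F z)}.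
  case: k cF => [|k] cF; first exact: cF.
  by have [dD _] := cF l; apply: differentiable_continuous; exact: dD.
apply: near_eq_continuous (continuous_comp cFl (@coord_continuous _ _ _ i j _)).
near=> z; rewrite /= derive_mx ?mxE//; apply: diff_derivable.
by apply: dF; near: z.
Unshelve. all: by end_near. Qed.

Lemma C1at_det m (A : 'rV[R]_n -> 'M[R]_m) x :
  (forall i j, C1at (fun z => A z i j) x) -> C1at (fun z => \det (A z)) x.
Proof.
move=> CA; apply: C1at_sum => s; apply: C1atM; first exact: C1at_cst.
exact: C1at_prod.
Qed.

(** Cramer's formula. It describes [invmx] where the determinant is nonzero, which by continuity
    holds in a neighbourhood of [x]. *)
Lemma C1at_invmx m (A : 'rV[R]_n -> 'M[R]_m) x i j :
  (forall i j, C1at (fun z => A z i j) x) -> \det (A x) != 0 ->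
  C1at (fun z => invmx (A z) i j) x.
Proof.
move=> CA A0; have Cd := C1at_det CA.
have : C1at (fun z => (\det (A z))^-1 * (\adj (A z)) i j) x.
  apply: C1atM; first exact: C1atV.
  under eq_fun do rewrite !mxE.
  apply: C1atM; first exact: C1at_cst.
  apply: C1at_det => k l.
  by under eq_fun do rewrite !mxE; exact: CA.
have nz : \forall s \near \det (A x), s != 0 :> R.
  by apply: open_nbhs_nbhs; split => //; exact: open_neq.
have {}nz := C1at_continuous Cd nz; rewrite /= in nz.
apply: near_eq_C1at; near=> z.
have : \det (A z) != 0.
  by near: z.
by rewrite /invmx unitmxE unitfE => ->; rewrite [RHS]mxE.
Unshelve. all: by end_near. Qed.

End C1at.

(** * A C^1 bump function *)

Section bump.
Context {R : realType}.

(** The positive part, squared to become C^1 at 0. *)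
Definition posq (u : R) : R := Num.max u 0 ^+ 2.

Lemma is_derive_posq (u : R) : is_derive u 1 posq (2 * Num.max u 0).
Proof.
have [u0|u0|->] := ltgtP u 0.
- have : is_derive u 1 (cst 0 : R -> R) (0 : R) by exact: is_derive_cst.
  rewrite mulr0; apply: near_eq_is_derive; near=> z.
  have z0 : z < 0 by near: z; apply: open_nbhs_nbhs; split => //;
      exact: open_lt.
  by rewrite /posq max_r ?expr0n// ltW.
- have : is_derive u 1 (fun z : R => z ^+ 2) (2 * u).
    split; first exact: exprn_derivable.
    by rewrite exp_derive !scaler1 expr1.
  apply: near_eq_is_derive; near=> z.
  have z0 : 0 < z by near: z; apply: open_nbhs_nbhs; split => //;
      exact: open_gt.
  by rewrite /posq max_l// ltW.
- rewrite mulr0.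
  (* At 0 the difference quotient is at most [|h|] in absolute value. *)
  have H : (fun h : R => h^-1 *: ((posq \o shift 0) (h *: 1) - posq 0)) @ 0^'
      --> (0 : R).
    apply/cvgrPdist_le => e e0; near=> h.
    have h0 : h != 0 by near: h; exact: nbhs_dnbhs_neq.
    have he : `|h| <= e by near: h; exact: dnbhs0_le.
    rewrite sub0r normrN /posq /= addr0 maxxx expr0n subr0 scaler1.
    rewrite normrM normfV ler_pdivrMl ?normr_gt0// normrX.
    apply: (@le_trans _ _ (`|h| ^+ 2)); last by rewrite expr2 ler_wpM2l.
    rewrite lerXn2r ?nnegrE//.
    by have [_|_] := leP h 0; rewrite ?normr0.
  by split; [apply/cvg_ex; exists 0|exact/cvg_lim].
Unshelve. all: by end_near. Qed.

Lemma continuous_posq' : continuous (posq^`()%classic).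
Proof.
rewrite (_ : posq^`()%classic = fun u => 2 * Num.max u 0); last first.
  by apply/funext => u; have [_ H] := is_derive_posq u; rewrite derive1E.
move=> u; have cm : {for u, continuous (fun z : R => Num.max z 0)}.
  by apply: continuous_max; [exact: cvg_id|exact: cst_continuous].
exact: (continuousM (@cst_continuous _ _ (2 : R) u) cm).
Qed.

Lemma C1at_posq n (F : 'rV[R]_n -> R) x : C1at F x ->
    C1at (fun z => posq (F z)) x.
Proof.
move=> CF; apply: C1at_comp => //; last exact: continuous_posq'.
by near=> s; have [] := is_derive_posq s.
Unshelve. all: by end_near. Qed.

Context {n : nat}.

(** Balls of row vectors are cubes, since the norm is the maximum of the coordinates; hence for
    [r > 0] this product is positive exactly on the ball of radius [r]. *)
Definition bump (c : 'rV[R]_n) (r : R) (y : 'rV[R]_n) : R :=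
  \prod_(k < n) posq (r ^+ 2 - (y 0 k - c 0 k) ^+ 2).

Lemma bump_ge0 c r y : 0 <= bump c r y.
Proof. by apply: prodr_ge0 => k _; exact: sqr_ge0. Qed.

Lemma bump_gt0 c r y : ball c r y -> 0 < bump c r y.
Proof.
move=> [r0 cy]; apply: prodr_gt0 => k _; rewrite exprn_gt0// lt_max subr_gt0.
have := cy 0 k; rewrite /ball/= distrC => ycr.
by rewrite -real_normK ?num_real// ltr_pXn2r ?nnegrE ?normr_ge0 ?ycr// ltW.
Qed.

Lemma bump_eq0 c r y : 0 < r -> ~ closed_ball c r y -> bump c r y = 0.
Proof.
move=> r0 cy; have [k ck] : exists k, r <= `|y 0 k - c 0 k|.
  apply: contrapT => /forallNP H; apply: cy; apply: subset_closed_ball.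
  split=> // i k; rewrite (ord1 i) /ball/= distrC ltNge; apply/negP; exact: H.
rewrite /bump (bigD1 k)//= /posq max_r ?expr0n ?mul0r// subr_le0.
by rewrite -[leRHS]real_normK ?num_real// lerXn2r ?nnegrE ?normr_ge0// ltW.
Qed.

(** Meant for a transition map [T]: a bump defined in one chart is read in another. *)
Lemma C1at_bump p c r (T : 'rV[R]_p -> 'rV[R]_n) x :
  (forall k, C1at (fun z => T z 0 k) x) -> C1at (fun z => bump c r (T z)) x.
Proof.
move=> CT; apply: C1at_prod => k; apply: C1at_posq.
have CTk : C1at (fun z => T z 0 k + cst (- c 0 k) z) x.
  by apply: C1atD => //; exact: C1at_cst.
have := C1atD (C1at_cst (r ^+ 2) x) (C1atM (C1at_cst (-1) x) (C1atM CTk CTk)).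
apply: near_eq_C1at; near=> z.
by rewrite /= mulN1r -expr2.
Unshelve. all: by end_near. Qed.

End bump.

(** * Lebesgue measure on tuples *)

Section row_of_tuple.
Context {R : realType} {n : nat}.

Lemma measurable_box (D : set (measurableTypeR R)) : measurable D ->
  measurable [set t : n.-tuple (measurableTypeR R) | forall i, D (tnth t i)].
Proof.
move=> mD; rewrite (_ : mkset _ = \bigcap_(i in [set: 'I_n]) ((fun t =>
    tnth t i) @^-1` D)).
  apply: fin_bigcap_measurable => // i _.
  by rewrite -[X in measurable X]setTI; exact: measurable_tnth.
by apply/seteqP; split => t /= Ht i; [move=> _; exact: Ht|exact: (Ht i I)].
Qed.

Lemma measurable_row_of_tuple_ball (c : 'rV[R]_n) (r : R) :
  measurable (@row_of_tuple R n @^-1` ball c r).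
Proof.
have [r0|r0] := ltP 0 r; last first.
  rewrite (_ : _ @^-1` _ = set0) //; apply/seteqP; split => // t [r0' _].
  by move: r0'; rewrite ltNge r0.
rewrite (_ : _ @^-1` _ = \bigcap_(i in [set: 'I_n])
    ((fun t => tnth t i) @^-1` ball (c 0 i) r)).
  apply: fin_bigcap_measurable => // i _.
  rewrite -[X in measurable X]setTI; apply: measurable_tnth => //.
  by apply: open_measurable; exact: ball_open.
apply/seteqP; split => t /=.
  by move=> [_ H] i _; have := H 0 i; rewrite mxE.
by move=> H; split => // i j; rewrite (ord1 i) mxE; exact: (H j I).
Qed.

(** An open set is a countable union of balls with rational centres and radii [1/(k+1)], and the
    preimage of a ball is a finite intersection of conditions on single coordinates. This links the
    product sigma-algebra on tuples to the topology on row vectors. *)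
Lemma measurable_row_of_tuple_open (U : set 'rV[R]_n) : open U ->
  measurable (@row_of_tuple R n @^-1` U).
Proof.
move=> oU.
pose F (p : 'rV[rat]_n * nat) := if `[< ball (map_mx ratr p.1 :
    'rV[R]_n) p.2.+1%:R^-1 `<=` U >]
  then @row_of_tuple R n @^-1` ball (map_mx ratr p.1 : 'rV[R]_n) p.2.+1%:R^-1
  else set0.
rewrite (_ : _ @^-1` _ = \bigcup_p F p).
  apply: countable_bigcupT_measurable => // p; rewrite /F; case: ifP => // _.
  exact: measurable_row_of_tuple_ball.
apply/seteqP; split => [t /= Ut|t [p _]]; last first.
  by rewrite /F; case: ifP => // /asboolP pU /pU.
have /nbhs_ballP[e /= e0 eU] : nbhs (row_of_tuple t) U by exact: open_nbhs_nbhs.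
(* A ball of radius below [e / 2] that contains the point lies in the ball of radius [e] around
   it. *)
have [k ke] : exists k, k.+1%:R^-1 < e / 2.
  have /cvgrPdist_lt/(_ (e / 2)) := @cvg_harmonic R.
  rewrite divr_gt0// => /(_ isT)[N _ /(_ N (leqnn N))].
  by rewrite sub0r normrN ger0_norm ?harmonic_ge0// => H; exists N.
have /choice[q qP] : forall i, exists q : rat, ball (tnth t i :
    R) (k.+1%:R^-1) (ratr q).
  move=> i; have [] := @rat_in_itvoo R (tnth t i - k.+1%:R^-1) (tnth t i +
      k.+1%:R^-1).
    by rewrite ltrBlDr -addrA ltrDl addr_gt0.
  move=> q; rewrite in_itv/= => qP; exists q; rewrite /ball/=.
  by rewrite distrC ltr_distl.
exists (\row_i q i, k) => //; rewrite /F /= asboolT.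
  split => // i j; rewrite (ord1 i) !mxE; exact/ball_sym.
move=> y [_ qy]; apply: eU; split => // i j.
rewrite [e]splitr; apply: (@ball_triangle R R (ratr (q j) : R)).
  by have := qP j; rewrite (ord1 i) mxE; apply: le_ball; exact: ltW.
by have := qy i j; rewrite !mxE; apply: le_ball; exact: ltW.
Qed.

Lemma measurable_fun_row_of_tuple (U : set 'rV[R]_n) (f : 'rV[R]_n -> R) :
  open U -> (forall y, U y -> {for y, continuous f}) ->
  measurable_fun (@row_of_tuple R n @^-1` U) (f \o @row_of_tuple R n).
Proof.
move=> oU cf; apply: (measurability _ (RGenOpens.measurableE R)).
move=> _ [_ [a [b ->]] <-].
(* Continuity of [f] on the open set [U] makes the part of [U] sent into []a, b[] open. *)
rewrite -comp_preimage; apply: (@measurable_row_of_tuple_open (U `&` f @^-1`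
    `]a, b[)).
rewrite openE => y [Uy fy].
have nU : nbhs y U by exact: open_nbhs_nbhs.
apply: (filterI nU); apply: cf => //; apply: open_nbhs_nbhs; split => //.
Qed.

End row_of_tuple.

(** * Boxes and Fubini's theorem for powers of Lebesgue measure *)

Section power_measure_box.
Local Open Scope ereal_scope.
Context {R : realType}.
Notation T := (measurableTypeR R).
Notation box n B := [set t : n.-tuple T | forall i, (`|tnth t i : R| <= B)%R].

Lemma measurable_segment_box n (B : R) : measurable (box n B).
Proof.
apply: (@measurable_box R n [set x : R | (`|x| <= B)%R]).
rewrite (_ : mkset _ = `[(- B)%R, B]%classic); first exact: measurable_itv.
by apply/seteqP; split => x /=; rewrite in_itv/= ler_norml.
Qed.

Lemma lebesgue_tuple_box n (B : R) : lebesgue_tuple R n (box n B) < +oo.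
Proof.
elim: n => [|n ih].
  rewrite /lebesgue_tuple /= diracE; exact: ltry.
have mB : measurable [set x : T | (`|x : R| <= B)%R].
  rewrite (_ : mkset _ = `[(- B)%R, B]%classic); first exact: measurable_itv.
  by apply/seteqP; split => x /=; rewrite in_itv/= ler_norml.
rewrite /lebesgue_tuple /= /cons_measure /pushforward.
rewrite (_ : _ @^-1` _ = [set x : T | (`|x : R| <= B)%R] `*` box n B);
    last first.
  apply/seteqP; split => [[x t] /= H|[x t] [/= Hx Ht] i].
    split; first by have := H ord0.
    by move=> i; have := H (lift ord0 i); rewrite tnthS.
  have [j|] := unliftP ord0 i; last by move=> ->.
  by move=> ->; rewrite tnthS.
rewrite product_measure1E//; last exact: measurable_segment_box.
apply: lte_mul_pinfty => //.
rewrite ge0_fin_numE//.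
rewrite (_ : mkset _ = `[(- B)%R, B]%classic); last first.
  by apply/seteqP; split => x /=; rewrite in_itv/= ler_norml.
have := @lebesgue_measure_itv R `[(- B)%R, B]; rewrite /= => ->.
by case: ifPn => _; exact: ltry.
Qed.

Definition tuple_set n (t : n.-tuple T) (j : 'I_n) (x : R) : n.-tuple T :=
  [tuple if i == j then x : T else tnth t i | i < n].

(** Induction on [n] by Fubini's theorem. If [j] is a later coordinate, the first one is fixed and
    the induction hypothesis applies to the tail; if [j] is the first, it is integrated before the
    tail. The bound [C] and the box of finite measure give the integrability that Fubini's theorem
    requires. *)
Lemma integral_lebesgue_tuple0 n (B C : R) (G : n.-tuple T -> R) (j : 'I_n) :
  measurable_fun setT G -> (forall t, (`|G t| <= C)%R) ->
  (forall t, ~ box n B t -> G t = 0%R) ->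
  (forall t, \int[lebesgue_measure]_x (G (tuple_set t j x))%:E = 0) ->
  \int[lebesgue_tuple R n]_t (G t)%:E = 0.
Proof.
elim: n G j => [G []//|n ih] G j mG GC GB G0.
have iG : (lebesgue_tuple R n.+1).-integrable setT (EFin \o G).
  have -> : EFin \o G = (EFin \o G) \_ (box n.+1 B).
    apply/funext => t; rewrite patchE; case: ifPn => // /negP.
    by rewrite inE => /GB /= ->.
  apply/(integrable_mkcond _ (@measurable_segment_box n.+1 B)).
  apply: measurable_bounded_integrable.
  - exact: measurable_segment_box.
  - exact: lebesgue_tuple_box.
  - exact: measurable_funTS.
  - by exists C; split; rewrite ?num_real// => M CM t _;
      exact: le_trans (GC t) (ltW CM).
have iH : (lebesgue_measure \x lebesgue_tuple R n).-integrable setT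
    (EFin \o (G \o @tuple_cons _ T n)).
  apply/integrableP; split.
    by apply/measurable_EFinP; apply: measurableT_comp => //;
      exact: measurable_tuple_cons.
  have /integrableP[_] := iG; apply: le_lt_trans.
  have := @ge0_integral_pushforward _ _ _ _ _ _ (@measurable_tuple_cons _ T n)
    (lebesgue_measure \x lebesgue_tuple R n) setT (abse \o (EFin \o G))
        measurableT.
  rewrite preimage_setT => <- //.
    by apply: measurableT_comp => //; exact/measurable_EFinP.
  by move=> t _; exact: abse_ge0.
have E : \int[lebesgue_tuple R n.+1]_t (G t)%:E =
    \int[lebesgue_measure \x lebesgue_tuple R n]_p (G (tuple_cons p))%:E.
  apply: (integral_pushforward (@measurable_tuple_cons _ T n)) => //.
  exact/measurable_EFinP.
apply: (etrans E).
case: (unliftP ord0 j) G0 => [k ->|->] G0.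
  rewrite -(integral12_prod_meas1 iH); apply: integral0_eq => x _.
  apply: (ih (fun t => G (tuple_cons (x, t))) k) => //.
  - apply: measurableT_comp => //.
    apply: (measurableT_comp (@measurable_tuple_cons _ T n)).
    exact: pair1_measurable.
  - move=> t bt; apply: GB => bt'; apply: bt => i.
    by have := bt' (lift ord0 i); rewrite tnthS.
  - move=> t; rewrite -[RHS](G0 (tuple_cons (x, t))).
    apply: eq_integral => y _; congr (G _)%:E; apply: eq_from_tnth => i.
    rewrite tnth_mktuple; have [l ->|->] := unliftP ord0 i.
      by rewrite !tnthS tnth_mktuple (inj_eq lift_inj).
    by rewrite -[in RHS]/(tnth _ ord0).
rewrite -(integral21_prod_meas1 iH); apply: integral0_eq => t _.
(* The head 0 is arbitrary, since [tuple_set] overwrites it. *)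
rewrite -[RHS](G0 (@tuple_cons _ T n ((0%R : R) : T, t))).
apply: eq_integral => y _; congr (G _)%:E; apply: eq_from_tnth => i.
rewrite tnth_mktuple; have [l ->|-> //] := unliftP ord0 i.
by rewrite !tnthS.
Qed.
End power_measure_box.

(** * The divergence theorem in [R^n] *)

Section euclidean_divergence.
Context {R : realType} {n : nat}.
Notation T := (measurableTypeR R).
Notation mu := (@lebesgue_measure R).

Lemma measurable_fun_row_of_tupleT (f : 'rV[R]_n -> R) : continuous f ->
  measurable_fun setT (f \o @row_of_tuple R n).
Proof.
move=> cf; have := @measurable_fun_row_of_tuple R n setT f openT (fun y _ =>
    cf y).
by rewrite preimage_setT.
Qed.

(** Fundamental theorem of calculus on [[-(B + 1), B + 1]]: [f] vanishes at both ends and [df]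
    outside. The margin 1 is there because [f] is known to vanish only strictly beyond [B]. *)
Lemma integral_derive1_eq0 (f df : R -> R) (B : R) :
  (forall x : R, is_derive x (1 : R) f (df x)) -> continuous df ->
  (forall x, B < `|x| -> f x = 0) -> (\int[mu]_x (df x)%:E = 0)%E.
Proof.
move=> fdf cdf f0.
wlog B0 : B f0 / 0 <= B.
  move=> /(_ `|B|); apply => // x Bx; apply: f0.
  exact: le_lt_trans (ler_norm B) Bx.
have df0 x : B < `|x| -> df x = 0.
  move=> Bx; have [_ <-] := fdf x.
  rewrite -[RHS](@derive_cst _ _ _ (0 : R) x (1 : R)).
  apply: near_eq_derive; near=> y; apply: f0; near: y.
  by apply: cvgr_gt Bx; apply: norm_continuous.
have cf : continuous f.
  by move=> x; apply/differentiable_continuous/derivable1_diffP;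
      have [] := fdf x.
rewrite -[RHS](_ : (f (B + 1))%:E - (f (- (B + 1)))%:E = 0)%E; last first.
  rewrite !f0 ?subee//.
  - by rewrite normrN ger0_norm ?ltrDl// addr_ge0.
  - by rewrite ger0_norm ?ltrDl// addr_ge0.
have BB : - (B + 1) < B + 1.
  by rewrite gt0_cp// ltr_wpDl.
rewrite -(@continuous_FTC2 _ df f (- (B + 1)) (B + 1))//.
- rewrite [RHS]integral_mkcond; apply: eq_integral => x _; rewrite patchE.
  case: ifPn => // /negP; rewrite inE /= in_itv/= -ler_norml => /negP.
  by rewrite -ltNge => Bx; rewrite df0// (lt_trans _ Bx)// ltrDl.
- exact: continuous_subspaceT.
- split.
  + by move=> x _; have [] := fdf x.
  + by apply: cvg_at_right_filter; exact: cf.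
  + by apply: cvg_at_left_filter; exact: cf.
- by move=> x _; rewrite derive1E; have [] := fdf x.
Unshelve. all: by end_near. Qed.

Definition box_supported (B : R) (F : 'rV[R]_n -> R) :=
  forall y : 'rV[R]_n, ~ (forall i, `|y 0 i| <= B) -> F y = 0.

Lemma continuous_box_bounded (B : R) (F : 'rV[R]_n -> R) :
  continuous F -> box_supported B F -> exists C, forall y, `|F y| <= C.
Proof.
move=> cF F0.
have cB : compact [set y : 'rV[R]_n | forall i, (`[(- B), B]%classic :
    set R) (y 0 i)].
  by apply: (@rV_compact _ _ (fun=> `[(- B), B]%classic)) => _;
      exact: segment_compact.
have : bounded_set (F @` [set y : 'rV[R]_n | forall i, (`[(- B), B]%classic :
    set R) (y 0 i)]).
  by apply/compact_bounded/continuous_compact => //;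
      exact: continuous_subspaceT.
move=> [C [_ HC]]; exists (`|C| + 1) => y.
have [By|/F0 ->] := pselect (forall i, `|y 0 i| <= B); last first.
  by rewrite normr0 addr_ge0.
apply: (HC (`|C| + 1)); first by rewrite (le_lt_trans (ler_norm _))// ltrDl.
by exists y => //= i; rewrite in_itv/= -ler_norml.
Qed.

Lemma continuous_box_integrable (B : R) (F : 'rV[R]_n -> R) :
  continuous F -> box_supported B F ->
  (lebesgue_tuple R n).-integrable setT (EFin \o (F \o @row_of_tuple R n)).
Proof.
move=> cF F0; have [C FC] := continuous_box_bounded cF F0.
have mF : measurable_fun setT (F \o @row_of_tuple R n).
  exact: measurable_fun_row_of_tupleT.
set box := [set t : n.-tuple T | forall i, (`|tnth t i : R| <= B)%R].
rewrite (_ : _ \o _ = (EFin \o (F \o @row_of_tuple R n)) \_ box); last first.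
  apply/funext => t; rewrite patchE; case: ifPn => // /negP.
  rewrite inE /box /= => bt; rewrite F0// => H; apply: bt => i.
  by have := H i; rewrite mxE.
apply/(integrable_mkcond _ (@measurable_segment_box R n B)).
apply: measurable_bounded_integrable.
- exact: measurable_segment_box.
- exact: lebesgue_tuple_box.
- exact: measurable_funTS.
- by exists C; split; rewrite ?num_real// => M CM t _;
    exact: le_trans (FC _) (ltW CM).
Qed.

(** The complement of the closed box is open, so [F] is zero in a neighbourhood of each of its
    points. *)
Lemma box_supported_derive (B : R) (F : 'rV[R]_n -> R) v :
  box_supported B F -> box_supported B (fun y => 'D_v F y).
Proof.
move=> F0 y By.
have [i Bi] : exists i, B < `|y 0 i|.
  by apply: contrapT => /forallNP H; apply: By => i; rewrite leNgt; apply/negP;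
      exact: H.
rewrite -[RHS](@derive_cst _ _ _ (0 : R) y v).
apply: near_eq_derive; near=> z; apply: F0 => /(_ i); apply/negP;
    rewrite -ltNge.
near: z; apply: cvgr_gt Bi; apply: cvg_norm; exact: coord_continuous.
Unshelve. all: by end_near. Qed.

(** Integrating over the coordinate [j] separately reduces the claim to one variable, on each line
    parallel to the [j]-th axis. *)
Lemma integral_derive_eq0 (B : R) (F : 'rV[R]_n -> R) (j : 'I_n) :
  box_supported B F -> (forall y, derivable F y (delta_mx 0 j)) ->
  continuous (fun y => 'D_(delta_mx 0 j) F y) ->
  (\int[lebesgue_tuple R n]_t ('D_(delta_mx 0 j) F (row_of_tuple t))%:E = 0)%E.
Proof.
move=> F0 dF cdF.
have dF0 := @box_supported_derive B F (delta_mx 0 j) F0.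
have [C dFC] := continuous_box_bounded cdF dF0.
apply: (@integral_lebesgue_tuple0 R n B C (fun t =>
    'D_(delta_mx 0 j) F (row_of_tuple t)) j) => //.
- exact: (measurable_fun_row_of_tupleT cdF).
- move=> t bt; apply: dF0 => H; apply: bt => i.
  by have := H i; rewrite mxE.
move=> t; pose y0 : 'rV[R]_n := row_of_tuple (tuple_set t j 0).
have lineE x : row_of_tuple (tuple_set t j x) = x *: delta_mx 0 j + y0.
  apply/rowP => i; rewrite !mxE !tnth_mktuple eqxx/=.
  by case: ifPn => _; rewrite ?mulr1 ?mulr0 ?addr0 ?add0r.
under eq_integral do rewrite lineE.
apply: (@integral_derive1_eq0 (fun x => F (x *: delta_mx 0 j + y0)) _ B).
- move=> x; have E : (fun h : R => h^-1 *: (((fun x =>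
    F (x *: delta_mx 0 j + y0)) \o shift x) (h *: 1) - F (x *: delta_mx 0 j +
    y0))) =
     (fun h : R => h^-1 *: ((F \o shift (x *: delta_mx 0 j +
         y0)) (h *: delta_mx 0 j) - F (x *: delta_mx 0 j + y0))).
    by apply/funext => h; rewrite /= scaler1 scalerDl addrA.
  split; first by rewrite /derivable E; exact: dF.
  by rewrite /derive E.
- move=> x; apply: (@continuous_comp _ _ _ (fun x :
    R => x *: delta_mx 0 j + y0) (fun y => 'D_(delta_mx 0 j) F y));
    last exact: cdF.
  apply: continuousD; last exact: cst_continuous.
  exact: scalel_continuous.
- move=> x Bx; apply: F0 => /(_ j); apply/negP;
    rewrite -ltNge !mxE !tnth_mktuple !eqxx.
  by rewrite mulr1 addr0.
Qed.

End euclidean_divergence.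

(** * Integration against a density *)

Section integral_pushforward_density.
Local Open Scope ereal_scope.
Context d1 d2 (X : measurableType d1) (Y : measurableType d2) (R : realType).
Variables (mu : {measure set X -> \bar R}) (nu : {measure set Y -> \bar R}).
Variables (A : set X) (D : set Y) (phi : X -> Y) (w : X -> R).
Hypotheses (mA : measurable A) (mD : measurable D).
Hypotheses (mphi : measurable_fun A phi) (mw : measurable_fun A w).
Hypothesis w0 : forall x, (0 <= w x)%R.
Hypothesis nuE : forall B, measurable B ->
  nu (B `&` D) = \int[mu]_(x in A) ((w x)%:E * (\1_B (phi x))%:E).

Import HBNNSimple.

(** [nuE] is the case of indicator functions; linearity extends it to simple functions, and monotone
    convergence to nonnegative measurable ones. *)
Lemma ge0_integral_density (f : Y -> \bar R) :
  measurable_fun setT f -> (forall y, 0 <= f y) ->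
  \int[nu]_(y in D) f y = \int[mu]_(x in A) ((w x)%:E * f (phi x)).
Proof.
move=> mf f0.
pose f_ := nnsfun_approx measurableT mf.
have mfphi n : measurable_fun A (fun x => (f_ n (phi x))%:E).
  apply/measurable_EFinP.
  by apply: (@measurable_comp _ _ _ _ _ _ setT) => //; exact: measurable_funP.
have mwE : measurable_fun A (EFin \o w) by exact/measurable_EFinP.
transitivity (limn (fun n => \int[nu]_(y in D) (f_ n y)%:E)).
  rewrite -monotone_convergence//.
  - apply: eq_integral => y /[!inE] yD; apply/esym/cvg_lim => //.
    exact: cvg_nnsfun_approx.
  - by move=> n; exact/measurable_EFinP/measurable_funTS.
  - by move=> n y _; rewrite lee_fin.
  - by move=> y _ m n mn; rewrite lee_fin; exact/lefP/nd_nnsfun_approx.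
rewrite [X in limn X](_ : _ =
    (fun n => \int[mu]_(x in A) ((w x)%:E * (f_ n (phi x))%:E))).
  rewrite -monotone_convergence//; last 3 first.
    - by move=> n; apply: emeasurable_funM => //; exact: mfphi.
    - by move=> n x _; rewrite -EFinM lee_fin mulr_ge0.
    - move=> x _ m n mn; rewrite -!EFinM lee_fin ler_wpM2l//.
      exact/lefP/nd_nnsfun_approx.
  apply: eq_integral => x _; apply/cvg_lim => //.
  by apply: cvgeZl => //; exact: cvg_nnsfun_approx.
apply/funext => n.
have mphiB B : measurable B -> measurable_fun A (fun x => (\1_B (phi x) :
    R)%:E).
  move=> mB; apply/measurable_EFinP.
  have m1 : measurable_fun [set: Y] (\1_B : Y -> R) by exact: measurable_indic.
  exact: (measurableT_comp m1 mphi).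
transitivity (\sum_(k \in range (f_ n))
    \int[nu]_(y in D) (k * \1_(f_ n @^-1` [set k]) y)%:E).
  under eq_integral do rewrite fimfunE -fsumEFin//.
  rewrite ge0_integral_fsum//.
  - by move=> r; apply/measurable_EFinP/measurable_funM => //;
      exact: measurable_indic.
  - by move=> r y _; rewrite nnfun_muleindic_ge0.
transitivity (\sum_(k \in range (f_ n)) \int[mu]_(x in A)
    (k%:E * ((w x)%:E * (\1_(f_ n @^-1` [set k]) (phi x))%:E))); last first.
  rewrite -ge0_integral_fsum//.
  - apply: eq_integral => x _; rewrite fimfunE -fsumEFin// ge0_mule_fsumr.
      by apply: eq_fsbigr => r _; rewrite muleCA EFinM.
    by move=> r; rewrite nnfun_muleindic_ge0.
  - move=> r; apply: emeasurable_funM => //; apply: emeasurable_funM => //.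
    exact: mphiB.
  - move=> r x _; rewrite muleCA mule_ge0// ?lee_fin//.
    by have := @nnfun_muleindic_ge0 _ _ _ (f_ n) r (phi x).
apply: eq_fsbigr => r /set_mem [y _ ryE].
have r0 : (0 <= r)%R by rewrite -ryE.
rewrite integralZl_indic_nnsfun// integral_indic// nuE// ge0_integralZl//.
- by apply: emeasurable_funM => //; exact: mphiB.
- by move=> x _; rewrite mule_ge0// lee_fin.
Qed.

(** Both integrals are differences of integrals of positive and negative parts, and multiplication
    by [w], being nonnegative, commutes with taking these parts. *)
Lemma integral_density (f : Y -> R) :
  measurable_fun setT f ->
  \int[nu]_(y in D) (f y)%:E = \int[mu]_(x in A) (w x * f (phi x))%:E.
Proof.
move=> mf; have mfE : measurable_fun setT (EFin \o f) by exact/measurable_EFinP.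
rewrite integralE [RHS]integralE ge0_integral_density//;
    last exact: measurable_funepos.
rewrite ge0_integral_density//; last exact: measurable_funeneg.
congr (_ - _); apply: eq_integral => x _.
- by rewrite !funeposE EFinM maxe_pMr ?lee_fin// mule0.
- by rewrite !funenegE EFinM -muleN maxe_pMr ?lee_fin// mule0.
Qed.

End integral_pushforward_density.

(** * Charts *)

Lemma posdef_det_gt0 (F : rcfType) n (A : 'M[F]_n) :
  (forall v : 'rV[F]_n, v != 0 -> 0 < (v *m A *m v^T) 0 0) -> 0 < \det A.
Proof.
move=> Apos.
have sqr_gt0 (v : 'rV[F]_n) : v != 0 -> 0 < (v *m v^T) 0 0.
  move=> /rV0Pn[i vi]; rewrite mxE (bigD1 i)//= ltr_pwDl ?sumr_ge0//.
    by rewrite mxE -expr2 exprn_even_gt0.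
  by move=> j _; rewrite mxE -expr2 sqr_ge0.
(* The segment from the identity to [A] consists of positive definite, hence
   nonsingular, matrices; [p] is the determinant along it. *)
pose p : {poly F} :=
  \det (map_mx polyC (1%:M : 'M[F]_n) + 'X *: map_mx polyC (A - 1%:M)).
have pE t : p.[t] = \det (1%:M + t *: (A - 1%:M)).
  rewrite -horner_evalE -det_map_mx; congr (\det _); apply/matrixP => i j.
  by rewrite !mxE /= !horner_evalE hornerD hornerC hornerM hornerX hornerC.
have p1 : p.[1] = \det A by rewrite pE scale1r addrC subrK.
rewrite ltNge; apply/negP => A0.
(* [p] is 1 at 0 and supposedly nonpositive at 1, so it has a root in between; the sign is reversed
   because [poly_ivt] expects a passage from nonpositive to nonnegative. A kernel vector at the root
   will contradict positive definiteness. *)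
have [t /andP[t0 t1]] : exists2 t, 0 <= t <= 1 & root (- p) t.
  apply: poly_ivt => //; rewrite !hornerN oppr_le0 oppr_ge0 p1 A0 andbT.
  by rewrite pE scale0r addr0 det1 ler01.
rewrite rootN /root pE => /det0P[v v0 vA].
have : 0 < ((1 - t) *: (v *m v^T) + t *: (v *m A *m v^T)) 0 0.
  rewrite !mxE; have [->|t_neq0] := eqVneq t 0.
    by rewrite subr0 mul1r mul0r addr0; have := sqr_gt0 _ v0; rewrite mxE.
  rewrite ltr_wpDl//.
    rewrite mulr_ge0 ?subr_ge0//; have := ltW (sqr_gt0 _ v0); by rewrite mxE.
  apply: mulr_gt0; first by rewrite lt0r t_neq0.
  by have := Apos _ v0; rewrite mxE.
rewrite (_ : _ + _ = v *m (1%:M + t *: (A - 1%:M)) *m v^T).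
  by rewrite vA mul0mx mxE ltxx.
rewrite mulmxDr mulmxDl mulmx1 -scalemxAr -scalemxAl mulmxBr mulmxBl mulmx1.
by rewrite scalerBl scale1r scalerBr addrAC addrA.
Qed.

(** * Continuous functions on a topological space with its Borel sigma-algebra *)

Section borel.
Context {R : realType} {X : ptopologicalType}.

Lemma open_measurable_borel (U : set X) : open U ->
    measurable (U : set (borel X)).
Proof. exact: sub_sigma_algebra. Qed.

Lemma continuous_measurable_borel (f : X -> R) : continuous f ->
  measurable_fun setT (f : borel X -> R).
Proof.
move=> /continuousP cf; apply: (measurability _ (RGenOpens.measurableE R)).
move=> _ [_ [a [b ->]] <-]; rewrite setTI; apply: open_measurable_borel.
apply: cf; exact: interval_open.
Qed.

Lemma compact_continuous_bounded (f : X -> R) : compact [set: X] ->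
    continuous f ->
  exists C, forall x, `|f x| <= C.
Proof.
move=> cX cf.
have [C [_ HC]] : bounded_set (f @` [set: X]).
  by apply/compact_bounded/continuous_compact => //;
      exact: continuous_subspaceT.
exists (`|C| + 1) => x; apply: (HC (`|C| + 1)); last by exists x.
by rewrite (le_lt_trans (ler_norm _))// ltrDl.
Qed.

End borel.

(** * Charts as local homeomorphisms *)

Section chart.
Context {R : realType} {n : nat} {M : topologicalType} (c : chart R n M).

Lemma cinv_cdom y : cimg c y -> cdom c (cinv c y).
Proof. by move=> [x cx <-]; rewrite cmapK. Qed.

Lemma cinvK y : cimg c y -> c (cinv c y) = y.
Proof. by move=> [x cx <-]; rewrite cmapK. Qed.

Lemma cimg_cmap x : cdom c x -> cimg c (c x).
Proof. by exists x. Qed.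

Lemma open_cimg : open (cimg c).
Proof. exact: cimg_open. Qed.

Lemma near_cdom x : cdom c x -> \forall z \near x, cdom c z.
Proof. by move=> cx; apply: open_nbhs_nbhs; split => //; exact: cdom_open. Qed.

Lemma near_cimg y : cimg c y -> \forall z \near y, cimg c z.
Proof. by move=> cy; apply: open_nbhs_nbhs; split => //; exact: open_cimg. Qed.

Lemma near_cmap x (P : set 'rV[R]_n) : cdom c x -> (\forall y \near c x, P y) ->
  \forall z \near x, P (c z).
Proof. by move=> cx nP; exact: (cmap_continuous cx nP). Qed.

Lemma near_cinv y (P : set M) : cimg c y -> (\forall x \near cinv c y, P x) ->
  \forall z \near y, P (cinv c z).
Proof. by move=> cy nP; exact: (cinv_continuous cy nP). Qed.

(** The set is the image of [K] under [cinv c], hence compact, hence closed in a Hausdorff space.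
    This is what makes extension by zero from a chart well behaved at the boundary of its domain. *)
Lemma closed_chart_support (K : set 'rV[R]_n) : hausdorff_space M ->
  compact K -> K `<=` cimg c -> closed [set x | cdom c x /\ K (c x)].
Proof.
move=> hM cK Kc; rewrite (_ : mkset _ = cinv c @` K); last first.
  apply/seteqP; split => [x [cx Kx]|_ [y Ky <-]].
    by exists (c x) => //; exact: cmapK.
  by rewrite /= cinvK; [split => //; exact/cinv_cdom/Kc|exact: Kc].
apply: compact_closed => //; apply: continuous_compact => //.
apply: (@continuous_in_subspaceT _ _ K) => y /set_mem Ky.
by apply: cinv_continuous; exact: Kc.
Qed.

End chart.

(** * The volume measure in a chart *)

Section manifold_measure.
Context {R : realType} {n : nat} (M : closedRiemannian R n).
Implicit Types (i j : chart_index M) (x : M) (y : 'rV[R]_n).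

Lemma det_metric_gt0 i y : cimg (atlas i) y -> 0 < \det (metric i y).
Proof. by move=> iy; apply: posdef_det_gt0 => v; exact: metric_posdef. Qed.

Lemma sqrt_det_metric_gt0 i y : cimg (atlas i) y -> 0 < sqrt_det_metric i y.
Proof. by move=> iy; rewrite sqrtr_gt0 det_metric_gt0. Qed.

Lemma C1at_metric i y k l : cimg (atlas i) y ->
    C1at (fun z => metric i z k l) y.
Proof.
move=> iy.
exact: (Ck1_C1at_coord k l (@open_cimg _ _ _ _) (@metric_smooth _ _ M i 1) iy).
Qed.

Lemma C1at_sqrt_det_metric i y : cimg (atlas i) y -> C1at (sqrt_det_metric i) y.
Proof.
move=> iy; apply: C1at_sqrt; last exact: det_metric_gt0.
by apply: C1at_det => k l; exact: C1at_metric.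
Qed.

Lemma C1at_invmx_metric i y k l : cimg (atlas i) y ->
  C1at (fun z => invmx (metric i z) k l) y.
Proof.
move=> iy; apply: C1at_invmx; last by rewrite gt_eqF// det_metric_gt0.
by move=> a b; exact: C1at_metric.
Qed.

Lemma sqrt_det_metric_continuous i y : cimg (atlas i) y ->
  {for y, continuous (sqrt_det_metric i)}.
Proof. by move=> iy; exact/C1at_continuous/C1at_sqrt_det_metric. Qed.

Notation dom i := (@row_of_tuple R n @^-1` cimg (atlas i)).
Notation leb := (lebesgue_tuple R n).

Lemma measurable_chart_dom i : measurable (dom i).
Proof. by apply: measurable_row_of_tuple_open; exact: open_cimg. Qed.

Lemma measurable_cdom i : measurable (cdom (atlas i) : set (borel M)).
Proof. by apply: open_measurable_borel; exact: cdom_open. Qed.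

Lemma measurable_cinv i :
  measurable_fun (dom i) ((cinv (atlas i) \o @row_of_tuple R n) : _ -> borel M).
Proof.
apply: (@measurability _ _ _ (borel M) _ _ (@open M)) => // _ [U oU <-].
apply: (@measurable_row_of_tuple_open R n (cimg (atlas i) `&` cinv (atlas i)
    @^-1` U)).
rewrite openE => y [iy Uy].
apply: (filterI (near_cimg iy)); apply: near_cinv => //.
exact: open_nbhs_nbhs.
Qed.

Lemma measurable_sqrt_det_metric i :
  measurable_fun (dom i) (sqrt_det_metric i \o @row_of_tuple R n).
Proof.
apply: measurable_fun_row_of_tuple; first exact: open_cimg.
exact: sqrt_det_metric_continuous.
Qed.

(** [volumeE] in the form that [integral_density] takes as hypothesis: the set moves from the domain
    of integration into an indicator function. *)
Lemma volume_chartE i (B : set (borel M)) : measurable B ->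
  (volume M (B `&` cdom (atlas i)) =
  \int[leb]_(t in dom i) ((sqrt_det_metric i (row_of_tuple t))%:E *
    (\1_B (cinv (atlas i) (row_of_tuple t)))%:E))%E.
Proof.
move=> mB; rewrite (volumeE (i := i)); last 2 first.
- by apply: measurableI => //; exact: measurable_cdom.
- exact: subIsetr.
pose E := dom i `&` (fun t => cinv (atlas i) (row_of_tuple t)) @^-1` B.
rewrite (_ : _ @^-1` _ = E); last first.
  apply/seteqP; split => t; rewrite /E /=.
    by move=> [x [Bx ix] <-]; split; [exact: cimg_cmap|rewrite /= cmapK].
  move=> [it Bt]; exists (cinv (atlas i) (row_of_tuple t)); last exact: cinvK.
  by split => //; exact: cinv_cdom.
rewrite /E integral_mkcondr; apply: eq_integral => t _.
rewrite patchE indicE /=; have ->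
    : (t \in (fun t => cinv (atlas i) (row_of_tuple t)) @^-1` B) =
  (cinv (atlas i) (row_of_tuple t) \in B) by [].
by case: ifPn => _; rewrite ?mule1 ?mule0.
Qed.

Lemma integral_chart i (f : M -> R) : continuous f ->
  (\int[volume M]_(x in cdom (atlas i)) (f x)%:E =
   \int[leb]_(t in dom i) (sqrt_det_metric i (row_of_tuple t) *
     f (cinv (atlas i) (row_of_tuple t)))%:E)%E.
Proof.
move=> cf; apply: (@integral_density _ _ _ _ R leb (volume M)
  (dom i) (cdom (atlas i)) _ (fun t => sqrt_det_metric i (row_of_tuple t))).
- exact: measurable_chart_dom.
- exact: measurable_cdom.
- exact: measurable_cinv.
- exact: measurable_sqrt_det_metric.
- by move=> t; exact: sqrtr_ge0.
- exact: volume_chartE.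
- exact: continuous_measurable_borel.
Qed.

Definition chart_support i (K : set 'rV[R]_n) :=
    compact K /\ K `<=` cimg (atlas i).

Definition pull i (H : 'rV[R]_n -> R) (x : M) : R :=
  if pselect (cdom (atlas i) x) then H (atlas i x) else 0.

Lemma pullE i H x : cdom (atlas i) x -> pull i H x = H (atlas i x).
Proof. by rewrite /pull; case: pselect. Qed.

Lemma pull_out i H x : ~ cdom (atlas i) x -> pull i H x = 0.
Proof. by rewrite /pull; case: pselect. Qed.

(** The part of [M] corresponding to [K] is closed, so the points near [x] avoid it as well; there
    [H] vanishes or [pull] takes its default value 0. *)
Lemma near_pull0 i K H x : chart_support i K -> (forall y, ~ K y -> H y = 0) ->
  ~ (cdom (atlas i) x /\ K (atlas i x)) -> \forall z \near x, pull i H z = 0.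
Proof.
move=> [cK Ki] H0 xK.
have : open (~` [set x | cdom (atlas i) x /\ K (atlas i x)]).
  by apply: closed_openC; apply: closed_chart_support => //; exact: hausdorff.
move=> oK; have : \forall z \near x, ~ (cdom (atlas i) z /\ K (atlas i z)).
  exact: open_nbhs_nbhs.
apply: filterS => z zK; have [iz|iz] := pselect (cdom (atlas i) z).
  by rewrite pullE// H0// => Kz; exact: zK.
exact: pull_out.
Qed.

Lemma near_pullE i H x : cdom (atlas i) x ->
    \forall z \near x, H (atlas i z) = pull i H z.
Proof. by move=> /near_cdom; apply: filterS => z iz; rewrite pullE. Qed.

Lemma continuous_pull i K H : chart_support i K -> (forall y, ~ K y ->
    H y = 0) ->
  (forall y, cimg (atlas i) y -> {for y, continuous H}) ->
      continuous (pull i H).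
Proof.
move=> iK H0 cH x; have [ix|ix] := pselect (cdom (atlas i) x).
  apply: near_eq_continuous (near_pullE H ix) _.
  apply: continuous_comp; first exact: cmap_continuous.
  exact/cH/cimg_cmap.
apply: (@near_eq_continuous _ _ (cst 0)); last exact: cst_continuous.
have : \forall z \near x, pull i H z = 0 by apply: near_pull0 iK H0 _ => -[].
by apply: filterS => z ->.
Qed.

(** Both sides reduce to the chart: [pull] is 0 outside its domain, and [H] is 0 outside its image,
    where [sqrt_det_metric] has no meaning. *)
Lemma integral_pull i K H : chart_support i K -> (forall y, ~ K y -> H y = 0) ->
  (forall y, cimg (atlas i) y -> {for y, continuous H}) ->
  (\int[volume M]_x (pull i H x)%:E =
   \int[leb]_t (sqrt_det_metric i (row_of_tuple t) * H (row_of_tuple t))%:E)%E.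
Proof.
move=> iK H0 cH.
transitivity (\int[volume M]_(x in cdom (atlas i)) (pull i H x)%:E)%E.
  rewrite [RHS]integral_mkcond; apply: eq_integral => x _; rewrite patchE.
  by case: ifPn => // /negP; rewrite inE => /pull_out ->.
rewrite integral_chart; last exact: continuous_pull iK H0 cH.
rewrite integral_mkcond; apply: eq_integral => t _; rewrite patchE.
case: ifPn => [|/negP]; rewrite inE /= => it.
  by rewrite pullE ?cinvK//; exact: cinv_cdom.
by rewrite H0 ?mulr0//; apply: contra_not it; exact: iK.2.
Qed.

End manifold_measure.

(** * Partition of unity *)

Lemma open_overlap (R : realType) (n : nat) (M : topologicalType) (c c' :
    chart R n M) :
  open (overlap c c').
Proof.
rewrite (_ : overlap c c' = cimg c `&` cinv c @^-1` cdom c'); last first.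
  apply/seteqP; split => [_ [x [cx c'x] <-]|y [cy c'y]].
    by split; [exact: cimg_cmap|rewrite /= cmapK].
  by exists (cinv c y); [split => //; exact: cinv_cdom|exact: cinvK].
rewrite openE => y [cy c'y]; apply: (filterI (near_cimg cy)).
by apply: near_cinv => //; exact: near_cdom.
Qed.

Section partition_of_unity.
Context {R : realType} {n : nat} (M : closedRiemannian R n).
Implicit Types (i j : chart_index M) (x : M) (y : 'rV[R]_n) (phi : M -> R).

Definition C1M phi := forall j y, cimg (atlas j) y -> C1at (local_rep j phi) y.

Definition supported phi i (K : set 'rV[R]_n) :=
  forall x, ~ (cdom (atlas i) x /\ K (atlas i x)) -> phi x = 0.

Lemma C1M_continuous phi : C1M phi -> continuous phi.
Proof.
move=> Cphi x; have [i ix] := atlas_cover x.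
have : {for x, continuous (local_rep i phi \o atlas i)}.
  apply: continuous_comp; first exact: cmap_continuous.
  exact/C1at_continuous/Cphi/cimg_cmap.
apply: near_eq_continuous; apply: filterS (near_cdom ix) => z iz.
by rewrite /local_rep /= cmapK.
Qed.

Lemma pull_bump_ge0 i c r x : 0 <= pull i (bump c r) x.
Proof.
have [ix|/pull_out -> //] := pselect (cdom (atlas i) x).
by rewrite pullE//; exact: bump_ge0.
Qed.

(** Seen from a chart [j], a point outside the domain of chart [i] has a neighbourhood where the
    function is zero, as the support is closed; at any other point the function is the bump composed
    with a smooth transition map. *)
Lemma C1M_pull_bump i c r : 0 < r -> chart_support i (closed_ball c r) ->
  C1M (pull i (bump c r)).
Proof.
move=> r0 iK j y jy.
have [ix|ix] := pselect (cdom (atlas i) (cinv (atlas j) y)); last first.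
  have : \forall x \near cinv (atlas j) y, pull i (bump c r) x = 0.
    by apply: (near_pull0 iK) => [z|[]//]; exact: bump_eq0.
  move=> /(near_cinv jy) H; apply: near_eq_C1at (C1at_cst 0 y).
  by apply: filterS H => z; rewrite /local_rep /= => ->.
have oy : overlap (atlas j) (atlas i) y.
  by exists (cinv (atlas j) y); [split => //; exact: cinv_cdom|exact: cinvK].
have : C1at (fun z => bump c r (transition (atlas j) (atlas i) z)) y.
  apply: C1at_bump => k.
  exact: (Ck1_C1at_coord 0 k (@open_overlap _ _ _ _ _) (@atlas_smooth _ _ M j i
      1) oy).
apply: near_eq_C1at; have := near_cinv jy (near_cdom ix).
by apply: filterS => z iz; rewrite /local_rep /= pullE.
Qed.

Lemma closed_ball_support i y : cimg (atlas i) y ->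
  exists2 r, 0 < r & chart_support i (closed_ball y r).
Proof.
move=> iy; have /nbhs_ballP[e /= e0 eU] := near_cimg iy.
(* Halving the radius puts the closed ball inside the open ball of radius [e], hence inside the
   image of the chart. *)
exists (e / 2); first by rewrite divr_gt0.
split.
  apply: bounded_closed_compact; last exact: closed_ball_closed.
  exists (`|y| + e); split; rewrite ?num_real// => C C0 z.
  rewrite closed_ballE ?divr_gt0// /closed_ball_ /= => yz.
  rewrite -[z](subKr y) (le_trans (ler_normB _ _))// (le_trans _ (ltW C0))//.
  by rewrite lerD2l (le_trans yz)// ler_pdivrMr// ler_peMr ?ltW// ltr1n.
apply: subset_trans eU; apply: closed_ball_subset; first by rewrite divr_gt0.
by rewrite ltr_pdivrMr// ltr_pMr// ltr1n.
Qed.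

(** By compactness finitely many coordinate balls cover [M]. The sum [S] of their bumps is then
    positive everywhere, and each bump is divided by it. *)
Lemma partition_of_unity : exists m (i : 'I_m -> chart_index M)
    (K : 'I_m -> set 'rV[R]_n) (phi : 'I_m -> M -> R),
  [/\ forall a, chart_support (i a) (K a),
      forall a, supported (phi a) (i a) (K a),
      forall a, C1M (phi a),
      forall a x, 0 <= phi a x &
      forall x, \sum_a phi a x = 1].
Proof.
have /choice[i iP] := @atlas_cover _ _ M.
have /choice[r rP] : forall x, exists r, 0 < r /\
    chart_support (i x) (closed_ball (atlas (i x) x) r).
  by move=> x; have [r r0 rK] := closed_ball_support (cimg_cmap (iP x));
      exists r.
pose U x := [set z | cdom (atlas (i x)) z /\ ball (atlas (i x) x) (r x) (atlas
    (i x) z)].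
have oU x : open (U x).
  rewrite openE => z [xz bz]; apply: (filterI (near_cdom xz)).
  apply: near_cmap => //; apply: open_nbhs_nbhs; split => //; exact: ball_open.
have [D _ DU] : finite_subset_cover [set: M] U [set: M].
  have := @compactT _ _ M; rewrite compact_cover; apply; first by move=> x _.
  move=> x _; exists x => //; split => //; apply: ballxx.
  by have [] := rP x.
pose s := in_tuple (enum_fset D).
pose b a := pull (i (tnth s a)) (bump (atlas (i (tnth s a)) (tnth s a)) (r (tnth
    s a))).
pose S x := \sum_a b a x.
have b0 a x : 0 <= b a x.
  by rewrite /b; exact: pull_bump_ge0.
have S0 x : 0 < S x.
  have [z zD [zx bx]] := DU x I.
  have zs : z \in s by [].
  have /tnthP[a za] := zs.
  rewrite /S (bigD1 a)//= ltr_pwDl ?sumr_ge0//.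
  by rewrite /b -za pullE//; exact: bump_gt0.
have Cb a : C1M (b a).
  by have [r0 rK] := rP (tnth s a); exact: C1M_pull_bump.
exists (size (enum_fset D)), (fun a => i (tnth s a)),
  (fun a => closed_ball (atlas (i (tnth s a)) (tnth s a)) (r (tnth s a))),
  (fun a x => b a x / S x).
split.
- by move=> a; have [] := rP (tnth s a).
- move=> a x xK; have [r0 rK] := rP (tnth s a).
  have := near_pull0 rK (fun y => @bump_eq0 _ _ _ _ y r0) xK.
  by move=> /nbhs_singleton; rewrite /b => ->; rewrite mul0r.
- move=> a j y jy; apply: C1atM; first exact: Cb.
  apply: C1atV; last by rewrite gt_eqF// /local_rep /= S0.
  exact: (C1at_sum _ (fun a => Cb a j y jy)).
- by move=> a x; rewrite divr_ge0// ltW.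
- by move=> x; rewrite -mulr_suml -/(S x) divff ?gt_eqF.
Qed.

End partition_of_unity.

(** * Gradient and divergence in charts *)

(** Transformation rule of the inverse metric under a change of chart. Invertibility of [G] forces
    that of [J] and [g], and [J^T *m invmx G *m J] is a right inverse of [g]. *)
Lemma pull_back_gram (R : comUnitRingType) n (J g G : 'M[R]_n) :
  G \in unitmx -> G = J *m g *m J^T -> J^T *m invmx G *m J = invmx g.
Proof.
move=> uG GE; move: (uG); rewrite {1}GE !unitmx_mul -andbA => /and3P[uJ ug _].
have H : g *m (J^T *m invmx G *m J) = 1%:M.
  apply: (can_inj (mulKmx uJ)); rewrite mulmx1 !mulmxA -GE.
  by rewrite mulmxV// mul1mx.
by rewrite -[LHS](mulKmx ug) H mulmx1.
Qed.

Lemma continuous_at_sum (R : realType) (T : topologicalType) (I : Type) (r :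
    seq I)
    (F : I -> T -> R) (x : T) :
  (forall i, {for x, continuous (F i)}) ->
  {for x, continuous (fun z => \sum_(i <- r) F i z)}.
Proof.
move=> cF; elim: r => [|a r ih].
  rewrite (_ : (fun z => _) = cst 0); first exact: cst_continuous.
  by apply/funext => z; rewrite big_nil.
rewrite (_ : (fun z => _) = F a \+ (fun z => \sum_(i <- r) F i z)).
  exact: continuousD.
by apply/funext => z; rewrite big_cons.
Qed.

Section gradient.
Context {R : realType} {n : nat} (M : closedRiemannian R n).
Implicit Types (i j : chart_index M) (x : M) (y : 'rV[R]_n) (f phi : M -> R).

(** The differential in coordinates; the inverse metric, which turns it into the gradient, enters in
    [flux] and [grad_dot]. *)
Definition gradc i f y : 'cV[R]_n := \col_k 'D_(delta_mx 0 k) (local_rep i f) y.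

(** [flux i f] is [sqrt (det g)] times the gradient of [f]. *)
Definition flux i f (k : 'I_n) y : R := sqrt_det_metric i y *
  \sum_(l < n) invmx (metric i y) k l * 'D_(delta_mx 0 l) (local_rep i f) y.

(** Inner product of the Riemannian gradients of [phi] and [f], computed in chart [i]. *)
Definition grad_dot i phi f x : R :=
  ((gradc i phi (atlas i x))^T *m invmx (metric i (atlas i x)) *m
   gradc i f (atlas i x)) 0 0.

Lemma grad_dotE i phi f x : cdom (atlas i) x -> grad_dot i phi f x =
  (sqrt_det_metric i (atlas i x))^-1 * \sum_k
     'D_(delta_mx 0 k) (local_rep i phi) (atlas i x) * flux i f k (atlas i x).
Proof.
move=> ix; rewrite /grad_dot -mulmxA mxE mulr_sumr; apply: eq_bigr => k _.
rewrite !mxE mulrCA /flux mulKf ?gt_eqF ?sqrt_det_metric_gt0//;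
    last exact: cimg_cmap.
by congr (_ * _); apply: eq_bigr => l _; rewrite mxE.
Qed.

(** Chain rule: near the point, the expression of [f] in chart [i] is its expression in chart [j]
    composed with the transition map. *)
Lemma gradc_transition i j f x : cdom (atlas i) x -> cdom (atlas j) x ->
  differentiable (local_rep j f) (atlas j x) ->
  gradc i f (atlas i x) =
  jacobian (transition (atlas i) (atlas j)) (atlas i x) *m gradc j f (atlas j
      x).
Proof.
move=> ix jx df; set tau := transition _ _.
have oy : overlap (atlas i) (atlas j) (atlas i x) by exists x.
have tauE : tau (atlas i x) = atlas j x by rewrite /tau /transition /= cmapK.
have dtau : differentiable tau (atlas i x).
  by have [H _] := @atlas_smooth _ _ M i j 1; exact: H.
have E : \forall z \near atlas i x, (local_rep j f \o tau) z = local_rep i f z.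
  have : \forall z \near cinv (atlas i) (atlas i x), cdom (atlas j) z.
    by rewrite cmapK//; exact: near_cdom.
  move=> /(near_cinv (cimg_cmap ix)); apply: filterS => z jz.
  by rewrite /local_rep /tau /transition /= cmapK.
apply/colP => k; rewrite mxE -(near_eq_derive _ E).
rewrite -tauE in df.
rewrite deriveE; last exact: differentiable_comp.
rewrite diff_comp//=.
(* Jacobians act on the right of row vectors, so a basis vector is sent to a row. *)
have -> : 'd tau (atlas i x) (delta_mx 0 k) = row k (jacobian tau (atlas i x)).
  by rewrite -deriveE// deriveEjacobian// rowE.
rewrite [row k _]row_sum_delta linear_sum /= !mxE; apply: eq_bigr => l _.
by rewrite linearZ /= !mxE -tauE (deriveE _ df).
Qed.

(** The two Jacobians produced by the chain rule are absorbed by the transformation rule of the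
    inverse metric. *)
Lemma grad_dot_chart i j phi f x : cdom (atlas i) x -> cdom (atlas j) x ->
  differentiable (local_rep j f) (atlas j x) ->
  differentiable (local_rep j phi) (atlas j x) ->
  grad_dot i phi f x = grad_dot j phi f x.
Proof.
move=> ix jx df dphi; rewrite /grad_dot.
rewrite (gradc_transition ix jx df) (gradc_transition ix jx dphi).
have oy : overlap (atlas i) (atlas j) (atlas i x) by exists x.
have := metric_compat oy; rewrite /= {2}/transition /= cmapK// => gE.
have ug : metric i (atlas i x) \in unitmx.
  by rewrite unitmxE unitfE gt_eqF// det_metric_gt0//; exact: cimg_cmap.
rewrite -(pull_back_gram ug gE) trmx_mul !mulmxA.
by [].
Qed.


Lemma C1at_flux i f k y : Ck 2 (cimg (atlas i)) (local_rep i f) ->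
  cimg (atlas i) y -> C1at (flux i f k) y.
Proof.
move=> [_ Cf] iy; apply: C1atM; first exact: C1at_sqrt_det_metric.
apply: C1at_sum => l; apply: C1atM; first exact: C1at_invmx_metric.
exact: (@Ck1_C1at _ _ 0 _ _ _ (@open_cimg _ _ _ _) (Cf l) iy).
Qed.

Lemma local_laplacianE i f y : local_laplacian i (local_rep i f) y =
  (sqrt_det_metric i y)^-1 * \sum_k 'D_(delta_mx 0 k) (flux i f k) y.
Proof. by []. Qed.

(** [K] is closed, so points near [y] also avoid it; there the first factor is 0, by the support of
    [phi] inside the chart image and by the default value of the patch outside. *)
Lemma near_patch0 i K phi (w : 'rV[R]_n -> R) y : chart_support i K ->
    supported phi i K ->
  ~ K y -> \forall z \near y, (local_rep i phi \_ (cimg (atlas i))) z * w z = 0.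
Proof.
move=> [cK Ki] phi0 Ky.
have : \forall z \near y, ~ K z.
  apply: open_nbhs_nbhs; split => //; apply: closed_openC.
  by apply: compact_closed => //; exact: norm_hausdorff.
apply: filterS => z Kz; rewrite patchE; case: ifPn; rewrite ?mul0r// inE => iz.
by rewrite /local_rep /= phi0 ?mul0r// cinvK// => -[].
Qed.

(** The cutoff [phi] makes the product C^1 on all of [R^n] although [w] is controlled only on the
    image of the chart. *)
Lemma C1at_patch i K phi (w : 'rV[R]_n -> R) y : chart_support i K ->
    supported phi i K ->
  C1M phi -> (forall z, cimg (atlas i) z -> C1at w z) ->
  C1at (fun z => (local_rep i phi \_ (cimg (atlas i))) z * w z) y.
Proof.
move=> iK phi0 Cphi Cw; have [iy|iy] := pselect (cimg (atlas i) y).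
  apply: near_eq_C1at (C1atM (Cphi i y iy) (Cw y iy)).
  apply: filterS (near_cimg iy) => z iz.
  by rewrite patchE mem_set.
apply: near_eq_C1at (C1at_cst 0 y).
have Ky : ~ K y by apply: contra_not iy; exact: iK.2.
by apply: filterS (near_patch0 w iK phi0 Ky) => z ->.
Qed.

Lemma compact_box (K : set 'rV[R]_n) : compact K ->
  exists B, forall y, K y -> forall k, `|y 0 k| <= B.
Proof.
move=> /compact_bounded[B [_ HB]]; exists (`|B| + 1) => y Ky k.
have : `|y| <= `|B| + 1.
  by apply: HB Ky; rewrite (le_lt_trans (ler_norm _))// ltrDl.
apply: le_trans; rewrite [leRHS]/Num.Def.normr /= mx_normrE.
exact: (le_bigmax _ (fun ij => `|y ij.1 ij.2|) (0, k)).
Qed.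

Lemma chart_support_box i K phi (w : 'rV[R]_n -> R) :
  chart_support i K -> supported phi i K ->
  exists B, box_supported B (fun z =>
      (local_rep i phi \_ (cimg (atlas i))) z * w z).
Proof.
move=> iK phi0; have [B HB] := compact_box iK.1; exists B => y By.
have Ky : ~ K y by move=> Ky; apply: By; exact: HB.
exact: nbhs_singleton (near_patch0 w iK phi0 Ky).
Qed.

Notation masked i phi w :=
  (fun z => (local_rep i phi \_ (cimg (atlas i))) z * w z).

(** The divergence of [phi *: grad f], for [phi] supported in chart [i]. *)
Definition chart_div i phi f : M ->
    R := pull i (fun y => (sqrt_det_metric i y)^-1 *
  \sum_k 'D_(delta_mx 0 k) (masked i phi (flux i f k)) y).

(** * The divergence of a gradient field cut off to one chart *)

Section chart_div.
Variables (i : chart_index M) (K : set 'rV[R]_n) (phi f h : M -> R).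
Hypotheses (iK : chart_support i K) (phi0 : supported phi i K) (Cphi : C1M phi).
Hypotheses (Cf : forall j, Ck 2 (cimg (atlas j)) (local_rep j f)).
Hypothesis fh : is_laplacian f h.

Let C1at_masked_flux k y : C1at (masked i phi (flux i f k)) y.
Proof. by apply: (C1at_patch y iK phi0 Cphi) => z iz; exact: C1at_flux. Qed.

Let derive_masked_flux0 k y : ~ K y ->
    'D_(delta_mx 0 k) (masked i phi (flux i f k)) y = 0.
Proof.
move=> Ky; rewrite -[RHS](@derive_cst _ _ _ (0 : R) y (delta_mx 0 k)).
exact: near_eq_derive (near_patch0 _ iK phi0 Ky).
Qed.

Let div0 y : ~ K y -> (sqrt_det_metric i y)^-1 *
  \sum_k 'D_(delta_mx 0 k) (masked i phi (flux i f k)) y = 0.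
Proof.
by move=> Ky; rewrite big1 ?mulr0// => k _; exact: derive_masked_flux0.
Qed.

Let continuous_div y : cimg (atlas i) y ->
    {for y, continuous (fun y => (sqrt_det_metric i y)^-1 *
  \sum_k 'D_(delta_mx 0 k) (masked i phi (flux i f k)) y)}.
Proof.
move=> iy; apply: continuousM.
  apply: continuousV; last exact: sqrt_det_metric_continuous.
  by rewrite gt_eqF// sqrt_det_metric_gt0.
apply: continuous_at_sum => k; exact: C1at_continuous_derive.
Qed.

Lemma continuous_chart_div : continuous (chart_div i phi f).
Proof. exact: (continuous_pull iK div0 continuous_div). Qed.

(** The volume density cancels the factor in front of the divergence, leaving a sum of partial
    derivatives of C^1 functions supported in a box. *)
Lemma integral_chart_div : (\int[volume M]_x (chart_div i phi f x)%:E = 0)%E.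
Proof.
rewrite (integral_pull iK div0 continuous_div).
transitivity (\int[lebesgue_tuple R n]_t (\sum_k
  ('D_(delta_mx 0 k) (masked i phi (flux i f k)) (row_of_tuple t))%:E))%E.
  apply: eq_integral => t _; rewrite sumEFin; congr (_%:E).
  have [it|it] := pselect (cimg (atlas i) (row_of_tuple t)).
    by rewrite mulVKf// gt_eqF// sqrt_det_metric_gt0.
  have Kt : ~ K (row_of_tuple t) by apply: contra_not it; exact: iK.2.
  by rewrite div0// mulr0 big1// => k _; exact: derive_masked_flux0.
have cD k : continuous (fun y => 'D_(delta_mx 0 k) (masked i phi (flux i f k))
    y).
  by move=> y; exact: C1at_continuous_derive.
rewrite integral_sum//; last first.
  move=> k; have [B HB] := chart_support_box (flux i f k) iK phi0.
  apply: (continuous_box_integrable (B := B) (cD k)).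
  exact: box_supported_derive.
apply: big1 => k _; have [B HB] := chart_support_box (flux i f k) iK phi0.
apply: (integral_derive_eq0 HB) => // y.
exact: C1at_derivable.
Qed.

(** Leibniz rule for [phi] times the flux: one term gives the Laplacian, the other the pairing of
    gradients. *)
Lemma chart_divE x : cdom (atlas i) x ->
  chart_div i phi f x = phi x * h x + grad_dot i phi f x.
Proof.
move=> ix; rewrite /chart_div pullE// grad_dotE// (fh ix) local_laplacianE.
rewrite mulrCA -mulrDr; congr (_ * _); rewrite mulr_sumr -big_split/=.
apply: eq_bigr => k _; have iy := cimg_cmap ix.
have E : \forall z \near atlas i x, masked i phi (flux i f k) z =
    local_rep i phi z * flux i f k z.
  by apply: filterS (near_cimg iy) => z iz; rewrite patchE mem_set.
rewrite (near_eq_derive _ E) deriveM; last 2 first.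
- exact/C1at_derivable/Cphi.
- exact/C1at_derivable/C1at_flux.
have <- : local_rep i phi (atlas i x) = phi x by rewrite /local_rep /= cmapK.
by congr (_ + _); exact: mulrC.
Qed.

(** Allows a single chart [j] around [x] to serve for every function of the partition. Inside chart
    [i] the pairing is independent of the chart; outside it, [phi] is zero near [x] and every term
    vanishes. *)
Lemma chart_div_grad_dot j x : cdom (atlas j) x ->
  chart_div i phi f x = phi x * h x + grad_dot j phi f x.
Proof.
move=> jx; have Df : differentiable (local_rep j f) (atlas j x).
  by have [H _] := Cf j; apply: H; exact: cimg_cmap.
have [ix|ix] := pselect (cdom (atlas i) x).
  rewrite chart_divE// (@grad_dot_chart i j)//.
  exact/C1at_differentiable/Cphi/cimg_cmap.
rewrite /chart_div pull_out// (phi0 (x := x)) ?mul0r ?add0r; last by case.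
have : \forall z \near cinv (atlas j) (atlas j x),
    ~ (cdom (atlas i) z /\ K (atlas i z)).
  rewrite cmapK//; apply: open_nbhs_nbhs; split; last by case.
  apply: closed_openC; apply: closed_chart_support;
      [exact: hausdorff|exact: iK.1|exact: iK.2].
move=> /(near_cinv (cimg_cmap jx)) H.
rewrite grad_dotE// big1 ?mulr0// => k _.
have E : \forall z \near atlas j x, local_rep j phi z = cst 0 z.
  by apply: filterS H => z iz; rewrite /local_rep /= phi0.
by rewrite (near_eq_derive _ E) derive_cst mul0r.
Qed.

End chart_div.

End gradient.

(** * The divergence theorem on a closed manifold *)

Section closed_manifold.
Context {R : realType} {n : nat} (M : closedRiemannian R n).

(** The volume is the sum of the integrals of the functions of a partition of unity, and each
    becomes the integral over [R^n] of a continuous function supported in a box. *)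
Lemma volume_finite : (volume M setT < +oo)%E.
Proof.
have [m [i [K [phi [iK phi0 Cphi phi_ge0 phi1]]]]] := partition_of_unity M.
have cphi a : continuous (phi a) by exact: C1M_continuous.
have -> : volume M setT = (\int[volume M]_x \sum_(a < m) (phi a x)%:E)%E.
  rewrite -[LHS]mul1e -(integral_cst (volume M) measurableT).
  by apply: eq_integral => x _; rewrite sumEFin phi1.
rewrite ge0_integral_sum//; last 2 first.
- move=> a; apply/measurable_EFinP; exact: continuous_measurable_borel.
- by move=> a x _; rewrite lee_fin.
apply: lte_sum_pinfty => a _.
pose H := local_rep (i a) (phi a) \_ (cimg (atlas (i a))).
have HK y : ~ K a y -> H y = 0.
  move=> Ky; have := nbhs_singleton (near_patch0 (cst 1) (iK a) (phi0 a) Ky).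
  by rewrite /= mulr1.
have CH y : C1at H y.
  have := C1at_patch y (iK a) (phi0 a) (Cphi a) (fun z _ => C1at_cst 1 z).
  by apply: near_eq_C1at; near=> z; rewrite mulr1.
have phiE x : phi a x = pull (i a) H x.
  have [ix|ix] := pselect (cdom (atlas (i a)) x).
    rewrite pullE// /H patchE mem_set; last exact: cimg_cmap.
    by rewrite /local_rep /= cmapK.
  by rewrite pull_out// phi0// => -[].
under eq_integral do rewrite phiE.
rewrite (integral_pull (iK a) HK); last by move=> y _; exact: C1at_continuous.
(* The density alone may be discontinuous outside the chart image; its product with the cutoff [H]
   is continuous everywhere. *)
pose W y := H y * sqrt_det_metric (i a) y.
have cW : continuous W.
  move=> y; apply: C1at_continuous;
      apply: (C1at_patch y (iK a) (phi0 a) (Cphi a)).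
  by move=> z iz; exact: C1at_sqrt_det_metric.
have [B WB] := chart_support_box (sqrt_det_metric (i a)) (iK a) (phi0 a).
under eq_integral do rewrite mulrC.
exact: integrable_lty (continuous_box_integrable cW WB).
Unshelve. all: by end_near. Qed.

Lemma continuous_integrable (f : M -> R) : continuous f ->
  (volume M).-integrable setT (EFin \o f).
Proof.
move=> cf; apply: measurable_bounded_integrable => //.
- exact: volume_finite.
- exact: continuous_measurable_borel.
have [C HC] := compact_continuous_bounded (@compactT _ _ M) cf.
by exists C; split; rewrite ?num_real// => D CD x _;
    exact: le_trans (HC x) (ltW CD).
Qed.

Theorem integral_laplacian (f h : M -> R) :
  (forall i, Ck 2 (cimg (atlas i)) (local_rep i f)) -> is_laplacian f h ->
  (\int[volume M]_x (h x)%:E = 0)%E.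
Proof.
move=> Cf fh.
have [m [i [K [phi [iK phi0 Cphi _ phi1]]]]] := partition_of_unity M.
have hE x : h x = \sum_(a < m) chart_div (i a) (phi a) f x.
  have [j jx] := atlas_cover x.
  (* All terms are expressed in the same chart [j], so that the gradients of the [phi a] can be
     added. *)
  under eq_bigr => a _ do rewrite (chart_div_grad_dot (iK a) (phi0 a) (Cphi a)
      Cf fh jx).
  rewrite big_split/= -mulr_suml phi1 mul1r.
  under eq_bigr => a _ do rewrite grad_dotE//.
  (* With the sum over [a] taken first, the [k]-th term contains the partial derivative of the sum
     of the [phi a], which is the constant 1. *)
  rewrite -mulr_sumr exchange_big/= big1 ?mulr0 ?addr0// => k _.
  rewrite -mulr_suml; have : forall a,
      differentiable (local_rep j (phi a)) (atlas j x).
    by move=> a; exact/C1at_differentiable/Cphi/cimg_cmap.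
  move=> dphi; rewrite -derive_sum; last by move=> a; exact: diff_derivable.
  rewrite (_ : \sum_(a < m) _ = cst 1) ?derive_cst ?mul0r//.
  by apply/funext => y; rewrite fct_sumE; exact: phi1.
under eq_integral do rewrite hE -sumEFin.
rewrite integral_sum//; last first.
  by move=> a; apply: continuous_integrable;
      exact: (continuous_chart_div (iK a) (phi0 a)).
apply: big1 => a _; exact: (integral_chart_div (iK a) (phi0 a)).
Qed.

(** Provides the existence from which the choice made by [get] in [heat_flow] is known to be a
    solution. *)
Lemma heat_solution_cst1 : @heat_solution R n M (fun _ _ => 1).
Proof.
have d0 (x : M) t : derive1 ((fun _ _ => 1 : R) x : R ->
    R) t = 0 by exact: derive1_cst.
have Dcst i v : (fun y => 'D_v (local_rep i (fun _ : M => 1 : R)) y) = cst 0.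
  by apply/funext => y; rewrite /local_rep; exact: derive_cst.
split.
- by move=> x t _; exact: cst_continuous.
- move=> i t _; split; first by move=> y _; exact: differentiable_cst.
  move=> k; rewrite Dcst; split; first by move=> y _; exact: differentiable_cst.
  move=> l y _; rewrite (_ : (fun z => _) = cst 0); first exact: cst_continuous.
  by apply/funext => z; rewrite derive_cst.
- by move=> x t _; exact: derivable_cst.
- move=> x t _; rewrite (_ : (fun p : M * R => _) = cst 0);
    first exact: cst_continuous.
  by apply/funext => p; exact: (d0 p.1 p.2).
- move=> t _ i x ix; rewrite d0//.
  apply/esym; rewrite [LHS](local_laplacianE i (fun _ : M => 1)).
  rewrite big1 ?mulr0// => k _.
  rewrite (_ : flux _ _ _ = cst 0) ?derive_cst//.
  apply/funext => y; rewrite /flux big1 ?mulr0// => l _.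
  by rewrite (congr1 (@^~ y) (Dcst i _)) mulr0.
- rewrite (_ : (fun t : R => _) = cst 0%E); first exact: cvg_cst.
  apply/funext => t; rewrite (_ : _ \o _ = cst 0%E) ?Lnorm0 ?eqe//.
  by apply/funext => x; rewrite /= subrr.
Qed.

Lemma heat_flowP : heat_solution (heat_flow M).
Proof. exact: (getI heat_solution_cst1). Qed.

End closed_manifold.

(** * Conservation of the heat content *)

Section heat_content.
Context {R : realType} {n : nat} (M : closedRiemannian R n).
Variable u : M -> R -> R.
Hypothesis hu : heat_solution u.

Let continuous_slice t : continuous ((fun x => (x, t)) : M -> M * R).
Proof.
move=> x A [[B C] /= [Bx Ct] BCA]; apply: filterS Bx => z Bz.
by apply: BCA; split => //=; exact: nbhs_singleton.
Qed.

Let continuous_u (t : R) : 0 < t -> continuous (u^~ t).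
Proof.
move=> t0 x; apply: (@continuous_comp _ _ _ ((fun x => (x, t)) : M ->
    M * R) (fun p : M * R => u p.1 p.2)).
  exact: continuous_slice.
exact: (heat_continuous hu).
Qed.

(** The time derivative is jointly continuous on the compact set [M * [a, b]]. The bound, uniform in
    [x], dominates it when differentiating under the integral. *)
Let dtu_bounded (a b : R) : 0 < a -> exists C,
  forall x t, a <= t <= b -> `|derive1 (u x) t| <= C.
Proof.
move=> a0; pose K := [set: M] `*` [set` `[a, b]].
have cK : compact K by apply: compact_setX;
    [exact: compactT|exact: segment_compact].
have [C [_ HC]] : bounded_set ((fun p : M * R => derive1 (u p.1) p.2) @` K).
  apply/compact_bounded/continuous_compact => //.
  apply: continuous_in_subspaceT => -[x t] /set_mem[_ /=].
  rewrite in_itv/= => /andP[at_ _]; apply: (heat_dt_continuous hu) => //=.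
  exact: lt_le_trans at_.
exists (`|C| + 1) => x t tab.
apply: (HC (`|C| + 1)); first by rewrite (le_lt_trans (ler_norm _))// ltrDl.
by exists (x, t).
Qed.

Let Q t := (\int[volume M]_x (u x t))%R.

(** Differentiation under the integral turns the derivative of [Q] into the integral of the time
    derivative of [u], that is, of a Laplacian. *)
Let is_derive_Q (t : R) : 0 < t -> is_derive t (1 : R) Q 0.
Proof.
move=> t0.
have t20 : 0 < t / 2 by rewrite divr_gt0.
(* The window from [t / 2] to [t * 2] contains [t] and stays away from time 0, near which no bound
   is available. *)
have [C HC] := @dtu_bounded (t / 2) (t * 2) t20.
have It : `]t / 2, (t * 2)[%classic t.
  by rewrite /= in_itv/= ltr_pdivrMr// !ltr_pMr// ltr1n.
have I0 s : `]t / 2, (t * 2)[%classic s -> 0 < s.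
  by rewrite /= in_itv/= => /andP[/(lt_trans t20)].
have intu s : `]t / 2, (t * 2)[%classic s ->
    (volume M).-integrable setT (EFin \o (u^~ s)).
  by move=> /I0 s0; apply: continuous_integrable; exact: continuous_u.
have du s x : `]t / 2, (t * 2)[%classic s -> setT x -> derivable (u x) s 1.
  by move=> /I0 s0 _; exact: (heat_derivable hu).
(* The absolute value makes the dominating constant nonnegative. *)
have iC : (volume M).-integrable setT (EFin \o (fun _ : borel M => `|C|)).
  by apply: continuous_integrable; exact: cst_continuous.
have HG s x : `]t / 2, (t * 2)[%classic s -> setT x ->
    `|partial1of2 (fun t x => u x t) s x| <= `|C|.
  rewrite /= in_itv/= => /andP[/ltW ts /ltW st] _.
  by apply: le_trans (ler_norm C); apply: HC; rewrite ts.
split.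
  exact: (@derivable_under_integral _ _ _ (volume M) (fun t x => u x t) setT
    measurableT _ _ _ It intu du (fun _ => `|C|) (fun _ => normr_ge0 C) iC HG).
rewrite -derive1E.
have -> := @differentiation_under_integral _ _ _ (volume M) (fun t x =>
    u x t) setT
    measurableT _ _ _ It intu du (fun _ => `|C|) (fun _ => normr_ge0 C) iC HG.
rewrite /Rintegral (integral_laplacian (f := u^~ t))//.
- by move=> i; exact: (heat_C2 hu).
- exact: (heat_eq hu).
Qed.

Let Q_cst (s t : R) : 0 < s -> 0 < t -> Q s = Q t.
Proof.
wlog st : s t / s < t.
  move=> H s0 t0; have [st|ts|->//] := ltgtP s t; first exact: H.
  by apply/esym; exact: H.
move=> s0 _.
have dQ x : x \in `]s, t[ -> is_derive x (1 : R) Q 0.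
  by rewrite in_itv/= => /andP[sx _]; apply: is_derive_Q; exact: lt_trans sx.
have cQ : {within `[s, t], continuous Q}.
  apply: continuous_in_subspaceT => x /set_mem /=;
      rewrite in_itv/= => /andP[sx _].
  have [dx _] := is_derive_Q (lt_le_trans s0 sx).
  exact/differentiable_continuous/derivable1_diffP.
have [c _] := @MVT _ Q (fun=> 0) s t st dQ cQ.
by rewrite mul0r => /eqP; rewrite subr_eq0 => /eqP.
Qed.

Let N t := ('N[volume M]_2%:E[EFin \o (fun x => u x t - 1)%R])%E.

(** Cauchy-Schwarz inequality, as Hölder's inequality with both exponents 2, for [u - 1] against the
    constant 1, whose L^2 norm is the square root of the volume. *)
Let Q_dist (t : R) : 0 < t ->
  (`|Q t - fine (volume M setT)|%:E <= N t * (volume M setT `^ 2^-1))%E.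
Proof.
move=> t0.
have vfin : volume M setT \is a fin_num by rewrite ge0_fin_numE// volume_finite.
have cu1 : continuous (fun x => u x t - 1).
  by move=> x; apply: continuousB; [exact: continuous_u|exact: cst_continuous].
have iu : (volume M).-integrable setT (EFin \o (u^~ t)).
  by apply: continuous_integrable; exact: continuous_u.
have i1 : (volume M).-integrable setT (EFin \o (fun _ : M => 1 : R)).
  by apply: continuous_integrable; exact: cst_continuous.
have iu1 := continuous_integrable cu1.
have -> : Q t - fine (volume M setT) = (\int[volume M]_x (u x t - 1))%R.
  rewrite RintegralB//; congr (_ - _).
  by rewrite /Rintegral integral_cst// mul1e.
apply: (@le_trans _ _ 'N[volume M]_1[EFin \o (fun x => u x t - 1)%R]%E).
  rewrite Lnorm1; apply: le_trans (le_abse_integral _ _ _) => //.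
    by rewrite /Rintegral -abse_EFin fineK//; exact: integrable_fin_num.
  exact: measurable_int iu1.
have m1 : measurable_fun setT (fun x : borel M => u x t - 1).
  exact: continuous_measurable_borel.
have := @hoelder _ _ _ (volume M) (fun x =>
    u x t - 1) (cst 1) 2 2 m1 (measurable_cst _).
rewrite Lnorm_cst1 => H.
apply: le_trans (H _ _ _) => //; last by rewrite [RHS]splitr !mul1r.
rewrite le_eqVlt; apply/orP; left; apply/eqP; apply: eq_Lnorm => x.
by rewrite /= mulr1.
Qed.

(** Since [Q] is constant, its distance to the volume at time [t] is bounded by the estimate
    [Q_dist] at every time [s > 0], and this bound tends to 0 with [s] by the initial condition. *)
Lemma heat_content_cst (t : R) : 0 < t ->
  (\int[volume M]_x (u x t)%:E = total_volume M)%E.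
Proof.
move=> t0.
have vfin : volume M setT \is a fin_num by rewrite ge0_fin_numE// volume_finite.
have iu : (volume M).-integrable setT (EFin \o (u^~ t)).
  by apply: continuous_integrable; exact: continuous_u.
have : (`|Q t - fine (volume M setT)|%:E <= 0)%E.
  have powfin : (volume M setT `^ 2^-1)%E \is a fin_num by exact: fin_num_poweR.
  have := cvgeZr powfin (heat_initial hu); rewrite mul0e; apply: cvge_ge.
  near=> s; have s0 : 0 < s by near: s; exact: nbhs_right_gt.
  by rewrite (Q_cst t0 s0); exact: Q_dist.
rewrite lee_fin normr_le0 subr_eq0 => /eqP QE.
rewrite /total_volume integral_cst// mul1e -(fineK vfin) -QE fineK//.
exact: integrable_fin_num.
Unshelve. all: by end_near. Qed.

End heat_content.

Theorem proposition1 (R : realType) (n1 n2 : nat)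
  (M1 : closedRiemannian R n1) (M2 : closedRiemannian R n2)
  (vol_eq : total_volume M1 = total_volume M2) :
  isoheat M1 M2.
Proof.
move=> t t0; rewrite /heat_content.
(* Each heat content equals the total volume of its manifold, which leaves [vol_eq]. *)
by rewrite !heat_content_cst//; exact: heat_flowP.
Qed.
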